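(* Let $(x_i,f_i)_{i\in\mathbb{N}}$ be a frame of an infinite dimensional Banach space $X$ for which there is a uniformly bounded sequence $(P_n)$ of finite rank projections on $X$ which approximate the identity, i.e. $x=\lim_{n\to\infty}P_n(x)$ in norm for all $x\in X$. Put $X_n=P_n(X)$. Assume that $(x_i,f_i)_{i\in\mathbb{N}}$ satisfies the $(\varepsilon,\delta,C)$-NQP with respect to a space $Z$ with basis $(z_i)$, for some choice of $\varepsilon>0$, $\delta>0$ and $C\ge 1$ such that $$q=\frac{1-r}{r}+\sup_n\|P_n\|\frac{2\varepsilon}{r}<1\quad\text{with }\tfrac12<r<1.$$ Let $(M_n)$ be any sequence in $\mathbb{N}$ which satisfies the following two conditions: (i) for all $n\in\mathbb{N}$, $\big\|x-\sum_{i=1}^Nf_i(x)P_n(x_i)\big\|\le(1-r)\|x\|$ whenever $x\in X_n$ and $N\ge M_n$; (ii) for all $n\in\mathbb{N}$ and all $x\in X_n$ there is a sequence $(k_i)_{i=1}^{M_n}\subset\mathbb{Z}$ such that $\big\|\sum_{i=1}^{M_n}k_i\delta z_i\big\|\le C\|x\|$ and $\big\|x-\sum_{i=1}^{M_n}\delta k_ix_i\big\|\le\varepsilon$. Finally assume that $(z_i)$ satisfies the lower estimate $$\lim_{n\to\infty}\inf\Big\{\Big\|\sum_{j\in A}n_jz_j\Big\|:(n_j)_{j\in A}\subset\mathbb{Z}\setminus\{0\},\ A\subset\mathbb{N},\ \#A=n\Big\}=\infty.$$ Then (a) $(M_n)$ increases exponentially with the dimension of $X_n$, i.e. there is a $c>1$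 such that $M_n\ge c^{\dim(X_n)}$ eventually; (b) $\displaystyle\limsup_{n\to\infty}\frac{\ln(n)}{n}\sup\Big\{\Big\|\sum_{i\in A}\pm z_i\Big\|:A\subset\mathbb{N},\ \#A=n\Big\}=\infty$, where the supremum is also taken over all choices of signs.
   Context: All Banach spaces are real; ''basis'' means Schauder basis. A sequence $(x_i,f_i)_{i\in\mathbb{N}}$, $x_i\in X$, $f_i\in X^*$, is a (Schauder) frame of $X$ if $x=\sum_{i=1}^\infty f_i(x)x_i$ in norm for every $x\in X$. A Banach space $Z$ with basis $(z_i)$ is associated to the frame if $S:Z\to X$, $\sum a_iz_i\mapsto\sum a_ix_i$, and $T:X\to Z$, $x\mapsto\sum_{x_i\ne0}f_i(x)z_i$, are well-defined bounded operators. The frame satisfies the $(\varepsilon,\delta,C)$-NQP with respect to $(Z,(z_i))$ if $(Z,(z_i))$ is associated to the frame and for all $x\in X$ there is a finitely supported $(k_i)\subset\mathbb{Z}$ with $\|\sum k_i\delta z_i\|_Z\le C\|x\|$ and $\|x-\sum\delta k_ix_i\|_X\le\varepsilon$. *)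

(* Defs.v *)
From mathcomp Require Import all_boot all_order all_algebra finmap.
From mathcomp Require Import all_classical all_reals all_analysis.

Set Implicit Arguments.
Unset Strict Implicit.
Unset Printing Implicit Defensive.

Import Order.TTheory GRing.Theory Num.Theory.
Import numFieldTopology.Exports numFieldNormedType.Exports.

Local Open Scope classical_set_scope.
Local Open Scope ring_scope.

(* Sequences indexed by {1, 2, ...} are indexed from 0 here, so that the first
   N terms of a sequence u are u 0, ..., u (N - 1) and their sum is
   \sum_(i < N) u i = series u N. *)

Definition lin_indep (R : realType) (X : lmodType R) (d : nat)
    (v : 'I_d -> X) : Prop :=
  forall a : 'I_d -> R, \sum_(i < d) a i *: v i = 0 -> forall i, a i = 0.

Definition lin_span (R : realType) (X : lmodType R) (d : nat)
    (v : 'I_d -> X) : set X :=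
  [set x | exists a : 'I_d -> R, x = \sum_(i < d) a i *: v i].

Definition has_dim (R : realType) (X : lmodType R) (V : set X) (d : nat) :
    Prop :=
  exists v : 'I_d -> X, lin_indep v /\ V = lin_span v.

Definition finite_dim (R : realType) (X : lmodType R) (V : set X) : Prop :=
  exists d : nat, has_dim V d.

(* The junk value 0 is taken when V is not a finite dimensional subspace; the
   dimension of V is otherwise the only d with has_dim V d (has_dim_uniq). *)
Definition lin_dim (R : realType) (X : lmodType R) (V : set X) : nat :=
  xget 0%N (has_dim V).

Lemma has_dim_le (R : realType) (X : lmodType R) (V : set X) (d e : nat) :
  has_dim V d -> has_dim V e -> (d <= e)%N.
Proof.
move=> [v [vI Vv]] [w [_ Vw]].
have vw i : exists a : 'I_e -> R, v i = \sum_(j < e) a j *: w j.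
  suff : V (v i) by rewrite Vw.
  rewrite Vv; exists (fun j => (j == i)%:R).
  rewrite (bigD1 i)//= eqxx scale1r big1 ?addr0// => j /negPf ->.
  by rewrite scale0r.
have [a va] := choice vw.
pose A := \matrix_(i < d, j < e) a i j.
suff /eqP <- : row_free A by exact: rank_leq_col.
apply: inj_row_free => u uA; apply/rowP => i; rewrite mxE.
apply: (vI (fun i => u 0 i)).
under eq_bigr do rewrite va scaler_sumr.
rewrite exchange_big big1//= => j _.
under eq_bigr do rewrite scalerA.
rewrite -scaler_suml.
have := congr1 (fun M : 'rV_e => M 0 j) uA; rewrite !mxE.
under eq_bigr do rewrite mxE.
by move=> ->; rewrite scale0r.
Qed.

Lemma has_dim_uniq (R : realType) (X : lmodType R) (V : set X) (d e : nat) :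
  has_dim V d -> has_dim V e -> d = e.
Proof. by move=> Vd Ve; apply/eqP; rewrite eqn_leq !(@has_dim_le _ _ V). Qed.

Lemma lin_dimE (R : realType) (X : lmodType R) (V : set X) (d : nat) :
  has_dim V d -> lin_dim V = d.
Proof.
by move=> Vd; apply: xget_unique => // e Ve; apply: has_dim_uniq Ve Vd.
Qed.

Definition opnorm (R : realType) (X Y : normedModType R) (T : X -> Y) : R :=
  sup [set `|T x| | x in [set x : X | `|x| <= 1]].

Definition schauder_basis (R : realType) (Z : normedModType R)
    (z : nat -> Z) : Prop :=
  forall y : Z, exists! a : nat -> R,
    series (fun i => a i *: z i) @ \oo --> y.

Definition schauder_frame (R : realType) (X : normedModType R)
    (x : nat -> X) (f : nat -> {linear X -> R^o}) : Prop :=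
  (forall i, continuous (f i)) /\
  (forall u : X, series (fun i => f i u *: x i) @ \oo --> u).

(* The operators S : \sum a_i z_i |-> \sum a_i x_i and
   T : u |-> \sum_(x_i != 0) f_i(u) z_i are well-defined and bounded. *)
Definition associated (R : realType) (X Z : normedModType R)
    (x : nat -> X) (f : nat -> {linear X -> R^o}) (z : nat -> Z) : Prop :=
  (exists S : {linear Z -> X}, continuous S /\
     forall (a : nat -> R) (y : Z),
       series (fun i => a i *: z i) @ \oo --> y ->
       series (fun i => a i *: x i) @ \oo --> S y) /\
  (exists T : {linear X -> Z}, continuous T /\
     forall u : X,
       series (fun i => if x i != 0 then f i u *: z i else 0) @ \oo --> T u).

Definition NQP (R : realType) (eps delta C : R) (X Z : normedModType R)
    (x : nat -> X) (f : nat -> {linear X -> R^o}) (z : nat -> Z) : Prop :=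
  associated x f z /\
  forall u : X, exists (N : nat) (k : nat -> int),
    [/\ forall i, (N <= i)%N -> k i = 0,
        `|\sum_(i < N) ((k i)%:~R * delta) *: z i| <= C * `|u| &
        `|u - \sum_(i < N) (delta * (k i)%:~R) *: x i| <= eps].

Definition finite_rank_projection (R : realType) (X : normedModType R)
    (P : {linear X -> X}) : Prop :=
  [/\ continuous P, forall u, P (P u) = P u & finite_dim (range P)].

Definition lower_norms (R : realType) (Z : normedModType R) (z : nat -> Z)
    (n : nat) : set R :=
  [set t | exists (A : {fset nat}) (k : nat -> int),
     [/\ #|` A| = n, forall j, j \in A -> k j != 0 &
         t = `|\sum_(j <- A) (k j)%:~R *: z j|]].

Definition sign_norms (R : realType) (Z : normedModType R) (z : nat -> Z)
    (n : nat) : set R :=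
  [set t | exists (A : {fset nat}) (s : nat -> bool),
     #|` A| = n /\ t = `|\sum_(j <- A) (-1) ^+ s j *: z j|].

(* Main.v *)
Require Import Defs.
From mathcomp Require Import all_boot all_order all_algebra finmap.
From mathcomp Require Import all_classical all_reals all_analysis.
From mathcomp Require Import ring lra zify.

Set Implicit Arguments.
Unset Strict Implicit.
Unset Printing Implicit Defensive.

Import Order.TTheory GRing.Theory Num.Theory.
Import numFieldTopology.Exports numFieldNormedType.Exports.

Local Open Scope classical_set_scope.
Local Open Scope ring_scope.

(* By the lower estimate, an integer combination sum k_i delta z_i of norm at
   most C has at most L nonzero coefficients, and since (z_i) is a basis these
   are bounded by some B.  Applying P_n to the combinations given by (ii) yields
   a 1/2-net of the unit ball of X_n, because sup |P_n| eps < 1/2.  A 1/2-net of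
   a d-dimensional ball has at least 2^d points, while there are only
   polynomially many combinations (in M_n), whence (a).  Moreover, the
   combinations only need the indices i with |P_n x_i| >= beta for a fixed
   beta > 0, so there are exponentially many (in d) such indices.

   If (b) fails, then for every eta > 0 some m is such that all sign sums of m
   of the z_i have norm at most eta m.  Hence a norm one functional on X_n is
   larger than tau at fewer than m of the P_n x_i.  Choosing for every large
   P_n x_i a functional norming it, a greedy selection keeps a proportion
   1/m of the large vectors, on which each functional is small at all later
   vectors.  Sums of s of the selected vectors are then beta/2-separated and lie
   in a ball of radius O(s), so that there are at most O(s)^d of them and
   the number of large vectors is at most O(s)^(d/s), up to a constant.  For s
   large this contradicts the exponential lower bound. *)

(* This turns volume comparisons up to constants into exact ones: covering and
   packing numbers of a ball are counted at the scales theta^q, for all q. *)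
Lemma leq_of_expn_leq (c a b : nat) :
  (forall q, a ^ q <= c * b ^ q)%N -> (a <= b)%N.
Proof.
move=> le_ab; rewrite leqNgt; apply/negP => lt_ba.
(* Bernoulli's inequality (1 + 1/b)^q >= 1 + q/b without denominators. At q = b c the ratio is at
   least 1 + c, whereas [le_ab] would bound it by c. *)
have bernoulli q : (b ^ q * (b + q) <= b * b.+1 ^ q)%N.
  elim: q => [|q IHq]; first by rewrite !expn0; lia.
  rewrite !expnS; nia.
have [b0|b_gt0] := posnP b.
  have := le_ab 1%N; rewrite b0 expn1 muln0; lia.
have c_gt0 : (0 < c)%N by have := le_ab 0%N; rewrite !expn0; lia.
have le_Sa : (b.+1 ^ (b * c) <= a ^ (b * c))%N.
  by rewrite leq_exp2r // muln_gt0 b_gt0.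
have := bernoulli (b * c)%N; have := le_ab (b * c)%N.
have : (0 < b ^ (b * c))%N by rewrite expn_gt0 b_gt0.
nia.
Qed.

(** * Finite dimensional subspaces *)

Section FiniteDimension.
Context {R : realType} {X : normedModType R}.

(** The norm of the combination is a continuous function of the coefficients and attains a minimum
    on the compact unit sphere of the sup norm. Independence makes the minimum positive, and
    homogeneity does the rest. *)
Lemma lin_indep_lower_bound d (v : 'I_d -> X) : lin_indep v ->
  exists2 b : R, 0 < b &
    forall (a : 'I_d -> R) i, b * `|a i| <= `|\sum_(j < d) a j *: v j|.
Proof.
case: d v => [|d] v indep_v; first by exists 1 => // a [].
pose f (u : 'rV[R]_d.+1) : R := `|\sum_(j < d.+1) u ord0 j *: v j|.
have le_coord (u : 'rV[R]_d.+1) i : `|u ord0 i| <= `|u|.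
  rewrite [leRHS]/Num.norm /= mx_normrE.
  exact: (le_bigmax _ (fun ij : 'I_1 * 'I_d.+1 => `|u ij.1 ij.2|) (ord0, i)).
have cont_f : continuous f.
  have cont_sum : continuous (fun u : 'rV[R]_d.+1 => \sum_(j < d.+1) u ord0 j *: v j).
    apply: (@continuous_big X _ _ _ _ (@add_continuous X)) => j _ u.
    apply: (@cvgZr_tmp _ _ _ _ (nbhs_filter u)).
    exact: (@coord_continuous R 1 d.+1 ord0 j u).
  by move=> u; apply: (@cvg_norm _ _ _ _ (nbhs_filter u)); exact: cont_sum.
pose S := [set u : 'rV[R]_d.+1 | `|u| = 1].
have S_scale (u : 'rV[R]_d.+1) : u != 0 -> S (`|u|^-1 *: u).
  by move=> u0; rewrite /S /= normrZ normfV normr_id mulVf ?normr_eq0.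
have S_neq0 : S !=set0.
  exists (`|const_mx 1 : 'rV[R]_d.+1|^-1 *: const_mx 1); apply: S_scale.
  by apply/eqP => /rowP /(_ ord0); rewrite !mxE => /eqP; rewrite oner_eq0.
have compact_S : compact S.
  apply: bounded_closed_compact.
    by exists 1; split => // M M1 u /= ->; exact: ltW.
  apply: (@closed_comp _ _ (fun u : 'rV[R]_d.+1 => `|u|) [set (1 : R)]).
    by move=> u _; exact: norm_continuous.
  exact: closed_eq.
have [c Sc min_c] := EVT_min_rV S_neq0 compact_S (continuous_subspaceT cont_f).
have c_neq0 : c != 0.
  apply: contraTneq Sc => ->; rewrite notin_setE /S /= normr0 => /esym/eqP.
  by rewrite oner_eq0.
exists (f c) => [|a i].
  rewrite normr_gt0; apply: contraNneq c_neq0 => fc0.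
  by apply/eqP/rowP => i; rewrite mxE; exact: indep_v fc0 i.
pose u : 'rV[R]_d.+1 := \row_j a j.
have fuE : f u = `|\sum_(j < d.+1) a j *: v j|.
  by rewrite /f; under eq_bigr do rewrite mxE.
have -> : a i = u ord0 i by rewrite mxE.
rewrite -fuE; have [->|u0] := eqVneq u 0.
  by rewrite mxE normr0 mulr0 normr_ge0.
have u_gt0 : 0 < `|u| by rewrite normr_gt0.
apply: (@le_trans _ _ (f c * `|u|)); first by rewrite ler_wpM2l ?le_coord ?normr_ge0.
rewrite -ler_pdivlMr //; apply: le_trans (min_c (`|u|^-1 *: u) _) _.
  by rewrite inE; exact: S_scale.
rewrite /f; under eq_bigr do rewrite mxE -scalerA.
by rewrite -scaler_sumr normrZ normfV normr_id mulrC.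
Qed.

Lemma lin_indep_span_dim d e (v : 'I_d -> X) (V : set X) : lin_indep v ->
  (forall i, V (v i)) -> has_dim V e -> (d <= e)%N.
Proof.
move=> indep_v Vv [w [_ VE]].
have vw i : exists a : 'I_e -> R, v i = \sum_(j < e) a j *: w j.
  by have := Vv i; rewrite VE.
have [a va] := choice vw.
pose A := \matrix_(i < d, j < e) a i j.
suff /eqP <- : row_free A by exact: rank_leq_col.
apply: inj_row_free => u uA; apply/rowP => i; rewrite mxE.
apply: (indep_v (fun i => u 0 i)).
under eq_bigr do rewrite va scaler_sumr.
rewrite exchange_big big1//= => j _.
under eq_bigr do rewrite scalerA.
rewrite -scaler_suml.
have := congr1 (fun M : 'rV_e => M 0 j) uA; rewrite !mxE.
under eq_bigr do rewrite mxE.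
by move=> ->; rewrite scale0r.
Qed.

Lemma lin_indep_exists d : ~ finite_dim [set: X] ->
  exists v : 'I_d -> X, lin_indep v.
Proof.
move=> infX; elim: d => [|d [v indep_v]]; first by exists (fun=> 0) => a _ [].
have [w notin_w] : exists w, ~ lin_span v w.
  apply: contrapT => /forallNP span_v; apply: infX; exists d, v; split => //.
  by apply/seteqP; split => // u _; apply: contrapT; exact: span_v.
exists (fun i => oapp v w (unlift ord_max i)) => a.
rewrite big_ord_recr /= unlift_none /=.
under eq_bigr => i _.
  have -> : unlift ord_max (widen_ord (leqnSn d) i) = Some i.
    have -> : widen_ord (leqnSn d) i = lift ord_max i.
      by apply/val_inj; rewrite /= /bump leqNgt ltn_ord.
    by rewrite liftK.
  over.
move=> /= sum0.
have a_max : a ord_max = 0.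
  apply/eqP; apply: contrapT => /negP amax_neq0; apply: notin_w.
  exists (fun i => - (a ord_max)^-1 * a (widen_ord (leqnSn d) i)).
  under eq_bigr do rewrite -scalerA.
  rewrite -scaler_sumr scaleNr -scalerN.
  have -> : - (\sum_(i < d) a (widen_ord (leqnSn d) i) *: v i) = a ord_max *: w.
    by apply/eqP; rewrite eq_sym -addr_eq0 addrC sum0.
  by rewrite scalerA mulVf // scale1r.
move: sum0; rewrite a_max scale0r addr0 => /indep_v a_w i.
have [j ->|->] := unliftP ord_max i; last exact: a_max.
have -> : lift ord_max j = widen_ord (leqnSn d) j.
  by apply/val_inj; rewrite /= /bump leqNgt ltn_ord.
exact: a_w.
Qed.

End FiniteDimension.

(** * Covering and packing of balls *)

Section Expansions.
Context {R : realType} {X : normedModType R}.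

(** Horner form of sum_j theta^j y(w_j), with the letters of w as digits. *)
Definition expansion (T : Type) (theta : R) (y : T -> X) (w : seq T) : X :=
  foldr (fun t u => y t + theta *: u) 0 w.

Lemma expansion_span d (v : 'I_d -> X) (T : Type) (theta : R) (y : T -> X) w :
  (forall t, lin_span v (y t)) -> lin_span v (expansion theta y w).
Proof.
move=> y_span; elim: w => [|t w [a /= ->]].
  by exists (fun=> 0); rewrite big1 // => i _; rewrite scale0r.
have [b ->] := y_span t; exists (fun i => b i + theta * a i).
rewrite scaler_sumr -big_split; apply: eq_bigr => i _ /=.
by rewrite scalerDl scalerA.
Qed.

(** A net refines itself: the error after the first digit, divided by theta, is again in the unit
    ball of V, so that each further digit gains a factor theta. *)
Lemma expansion_approx (T : finType) (V : set X) (theta : R) (y : T -> X) m u :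
    0 < theta ->
    (forall (t : T) u', V u' -> V (theta^-1 *: (u' - y t))) ->
    (forall u', V u' -> `|u'| <= 1 -> exists t, `|u' - y t| <= theta) ->
    V u -> `|u| <= 1 ->
  exists w : m.-tuple T, `|u - expansion theta y w| <= theta ^+ m.
Proof.
move=> th_gt0 V_step net; elim: m u => [|m IHm] u Vu u_le1.
  by exists [tuple]; rewrite /= subr0 expr0.
have [t t_near] := net u Vu u_le1.
have [||w w_near] := IHm (theta^-1 *: (u - y t)).
- exact: V_step.
- by rewrite normrZ gtr0_norm ?invr_gt0 // mulrC ler_pdivrMr // mul1r.
exists [tuple of t :: w] => /=.
have -> : u - (y t + theta *: expansion theta y w) =
    theta *: (theta^-1 *: (u - y t) - expansion theta y w).
  by rewrite scalerBr scalerA mulfV ?gt_eqF // scale1r opprD addrA.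
by rewrite normrZ gtr0_norm // exprS ler_pM2l.
Qed.

(** Take a grid of 2^(q d) points in the unit ball. Words of length q + s + 1 over T approximate its
    points so well that distinct points need distinct words, so (2^d)^q <= |T|^(s+1) |T|^q for all
    q. *)
Lemma half_net_card d (v : 'I_d -> X) (T : finType) (y : T -> X) :
    lin_indep v -> (forall t, lin_span v (y t)) ->
    (forall u, lin_span v u -> `|u| <= 1 -> exists t, `|u - y t| <= 2^-1) ->
  (2 ^ d <= #|T|)%N.
Proof.
move=> /lin_indep_lower_bound[b b_gt0 b_le] y_span net.
pose A : R := 1 + \sum_j `|v j|.
have A_gt0 : 0 < A by rewrite ltr_pwDl // sumr_ge0.
(* This makes twice the approximation error 2^-(q+s+1) smaller than b / (2^q A), the distance of two
   grid points guaranteed by [b_le]. *)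
pose s := Num.truncn (2 * A / b).
have lt_s : 2 * A / b < 2 ^+ s.+1.
  apply: (@lt_le_trans _ _ s.+1%:R); first by rewrite truncnS_gt.
  by rewrite -natrX ler_nat ltnW // ltn_expl.
apply: (@leq_of_expn_leq (#|T| ^ s.+1)) => q.
rewrite -expnD addnC.
pose pt (k : {ffun 'I_d -> 'I_(2 ^ q)}) := \sum_j ((k j)%:R / (2 ^+ q * A)) *: v j.
have pt_span k : lin_span v (pt k) by eexists.
have pt_le1 k : `|pt k| <= 1.
  apply: le_trans (ler_norm_sum _ _ _) _.
  apply: (@le_trans _ _ (\sum_j `|v j| / A)).
    apply: ler_sum => j _; rewrite normrZ mulrC ler_wpM2l //.
    rewrite ger0_norm; last by rewrite divr_ge0 // mulr_ge0 ?exprn_ge0 // ltW.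
    rewrite invfM mulrA ler_piMl // ?invr_ge0; first exact: ltW.
    by rewrite ler_pdivrMr ?exprn_gt0 // mul1r -natrX ler_nat ltnW.
  by rewrite -mulr_suml ler_pdivrMr // mul1r lerDr.
have step t u : lin_span v u -> lin_span v (2^-1^-1 *: (u - y t)).
  move=> [a ->]; have [c ->] := y_span t; exists (fun j => 2^-1^-1 * (a j - c j)).
  rewrite -sumrB scaler_sumr; apply: eq_bigr => j _.
  by rewrite -scalerBl scalerA.
have half_gt0 : 0 < 2^-1 :> R by rewrite invr_gt0.
have [w w_near] := choice (fun k =>
  expansion_approx (q + s.+1) half_gt0 step net (pt_span k) (pt_le1 k)).
have w_inj : injective w.
  move=> k k' eq_w; apply/ffunP => j; apply/eqP; apply: contraT => neq_j.
  have le_dist : `|pt k - pt k'| <= 2 * 2^-1 ^+ (q + s.+1).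
    rewrite mulr_natl mulr2n; apply: le_trans (ler_distD (expansion 2^-1 y (w k)) _ _) _.
    by apply: lerD => //; rewrite distrC eq_w.
  have := b_le (fun j => ((k j)%:R - (k' j)%:R) / (2 ^+ q * A)) j.
  have -> : \sum_j (((k j)%:R - (k' j)%:R) / (2 ^+ q * A)) *: v j = pt k - pt k'.
    by rewrite -sumrB; apply: eq_bigr => i _; rewrite mulrBl scalerBl.
  move=> /le_trans /(_ le_dist); rewrite leNgt; apply: contraNT => _.
  have ge1 : 1 <= `|(k j)%:R - (k' j)%:R| :> R.
    have : k j != k' j :> nat by [].
    rewrite neq_ltn => /orP[] lt_k; [rewrite distrC|];
      by rewrite -natrB 1?ltnW // ger0_norm // ler1n subn_gt0.
  apply: (@lt_le_trans _ _ (b * (1 / (2 ^+ q * A)))); last first.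
    have inv_ge0 : 0 <= (2 ^+ q * A)^-1 :> R.
      by rewrite invr_ge0 mulr_ge0 ?exprn_ge0 // ltW.
    by rewrite ler_pM2l // normrM (ger0_norm inv_ge0) ler_wpM2r.
  rewrite exprD mulrA [2 * _]mulrC -mulrA !exprVn mul1r invfM.
  rewrite [ltRHS]mulrCA ltr_pM2l ?invr_gt0 ?exprn_gt0 //.
  rewrite ltr_pdivrMr ?exprn_gt0 // -ltr_pdivrMl ?divr_gt0 //.
  by rewrite invf_div mulrC mulrA.
have := leq_card w w_inj.
by rewrite card_ffun !card_ord card_tuple -expnM mulnC expnM.
Qed.

(** For theta = 1/(K+1), the expansions of distinct words of length m are rho theta^m-separated in a
    fixed ball. They thus lie in distinct cells of a coordinate grid with (c (K+1)^m)^d cells. *)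
Lemma separated_card d (v : 'I_d -> X) (T : finType) (y : T -> X) (K : nat)
    (rho r0 : R) :
    lin_indep v -> (forall t, lin_span v (y t)) -> (0 < K)%N -> 0 < rho ->
    4 * r0 <= K%:R * rho -> (forall t, `|y t| <= r0) ->
    (forall s t, s != t -> rho <= `|y s - y t|) ->
  (#|T| <= K.+1 ^ d)%N.
Proof.
move=> /lin_indep_lower_bound[b b_gt0 b_le] y_span K_gt0 rho_gt0 le_K y_le y_sep.
have [T0|/card_gt0P[t0 _]] := posnP #|T|; first by rewrite T0.
have r0_ge0 : 0 <= r0 by apply: le_trans (y_le t0).
pose theta : R := K.+1%:R^-1.
have th_gt0 : 0 < theta by rewrite invr_gt0.
have th_le : theta <= 2^-1 by rewrite lef_pV2 ?posrE // ler_nat.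
have th_K : theta * K%:R = 1 - theta.
  have : theta * K.+1%:R = 1 by rewrite mulVf // pnatr_eq0.
  by rewrite -natr1 mulrDr mulr1; lra.
have exp_le w : `|expansion theta y w| <= 2 * r0.
  elim: w => [|t w IHw] /=; first by rewrite normr0 mulr_ge0.
  apply: le_trans (ler_normD _ _) _; rewrite normrZ gtr0_norm //.
  have := y_le t; have : theta * `|expansion theta y w| <= 2^-1 * (2 * r0).
    by apply: ler_pM => //; exact: ltW.
  lra.
have exp_sep m (w w' : seq T) : size w = m -> size w' = m -> w != w' ->
    rho * theta ^+ m <= `|expansion theta y w - expansion theta y w'|.
  elim: m w w' => [|m IHm] [|t w] [|t' w'] //= [sz_w] [sz_w'].
  rewrite eqseq_cons; have [-> /= neq_w|neq_t _] := eqVneq t t'.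
    rewrite opprD addrACA subrr add0r -scalerBr normrZ gtr0_norm //.
    by rewrite exprS mulrCA ler_pM2l // IHm.
  (* The tails differ by at most 4 r0, which costs at most theta 4 r0 <= (1 - theta) rho of the
     separation rho of the first digits; rho theta remains. *)
  apply: (@le_trans _ _ (rho * theta)).
    rewrite exprS mulrA ler_piMr //; first by rewrite ltW // mulr_gt0.
    by apply: exprn_ile1; [exact: ltW | apply: le_trans th_le _; lra].
  have := y_sep _ _ neq_t.
  have -> : y t + theta *: expansion theta y w - (y t' + theta *: expansion theta y w') =
      (y t - y t') - theta *: (expansion theta y w' - expansion theta y w).
    by rewrite scalerBr opprB opprD addrACA.
  have := lerB_normD (y t - y t')
    (- (theta *: (expansion theta y w' - expansion theta y w))).
  rewrite normrN normrZ gtr0_norm //.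
  have : theta * `|expansion theta y w' - expansion theta y w| <= theta * (4 * r0).
    rewrite ler_pM2l //; apply: le_trans (ler_normB _ _) _.
    by have := exp_le w; have := exp_le w'; lra.
  have : theta * (4 * r0) <= (1 - theta) * rho by rewrite -th_K -mulrA ler_pM2l.
  lra.
pose A : R := 1 + \sum_j `|v j|.
have A_gt0 : 0 < A by rewrite ltr_pwDl // sumr_ge0.
pose c := (Num.truncn (4 * r0 * A / (b * rho))).+1.
have lt_c : 4 * r0 * A / (b * rho) < c%:R by rewrite truncnS_gt.
apply: (@leq_of_expn_leq (c ^ d)) => m.
have [a aE] := choice (fun w : m.-tuple T => expansion_span theta w y_span).
have a_le w j : `|a w j| <= 2 * r0 / b.
  by rewrite ler_pdivlMr // mulrC (le_trans (b_le _ _)) // -aE.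
(* Points sharing all coordinate cells of side h are at distance at most h sum |v_j| < h A = rho
   theta^m. *)
have [h h_gt0 hE] : exists2 h : R, 0 < h & h = rho * theta ^+ m / A.
  by eexists; last reflexivity; rewrite divr_gt0 ?mulr_gt0 ?exprn_gt0.
pose cell w j := Num.truncn ((a w j + 2 * r0 / b) / h).
have cell_lt w j : (cell w j < c * K.+1 ^ m)%N.
  rewrite truncn_lt_nat; last first.
    by apply: divr_ge0 (ltW h_gt0); have := a_le w j; rewrite ler_norml; lra.
  apply: (@le_lt_trans _ _ (4 * r0 * A / (b * rho) * K.+1%:R ^+ m)); last first.
    by rewrite natrM natrX ltr_pM2r ?exprn_gt0.
  have -> : 4 * r0 * A / (b * rho) * K.+1%:R ^+ m = (4 * r0 / b) / h.
    rewrite hE /theta exprVn; field.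
    by rewrite -natr1 !lt0r_neq0 ?exprn_gt0 //.
  rewrite ler_pM2r ?invr_gt0 //.
  by have := a_le w j; rewrite ler_norml; lra.
pose code w := [ffun j => Ordinal (cell_lt w j)].
have code_inj : injective code.
  move=> w w' eq_code; apply/eqP; apply: contraT => neq_w.
  have := exp_sep m w w' (size_tuple w) (size_tuple w') neq_w.
  rewrite leNgt; apply: contraNT => _; rewrite !aE -sumrB.
  apply: (@le_lt_trans _ _ (h * \sum_j `|v j|)).
    apply: le_trans (ler_norm_sum _ _ _) _; rewrite mulr_sumr ler_sum // => j _.
    rewrite -scalerBl normrZ ler_wpM2r //.
    have : cell w j = cell w' j.
      by have := congr1 (fun g : {ffun _ -> _} => val (g j)) eq_code; rewrite !ffunE.
    rewrite /cell => eq_cell.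
    have cell_itv w0 : (cell w0 j)%:R <= (a w0 j + 2 * r0 / b) / h < (cell w0 j).+1%:R.
      apply: truncn_itv; apply: divr_ge0 (ltW h_gt0).
      by have := a_le w0 j; rewrite ler_norml; lra.
    have /andP[] := cell_itv w; have /andP[] := cell_itv w'.
    rewrite /cell eq_cell !ler_pdivlMr // !ltr_pdivrMr // -natr1 ler_norml.
    lra.
  have -> : rho * theta ^+ m = h * A by rewrite hE divfK ?gt_eqF.
  by rewrite ltr_pM2l // ltrDr.
have := leq_card code code_inj.
by rewrite card_ffun !card_ord card_tuple expnMn -!expnM [(m * d)%N]mulnC.
Qed.

End Expansions.

(** * Norming functionals on finitely many vectors *)

Section Norming.
Context {R : realType} {X : normedModType R}.

(** Hahn-Banach, adjoining one vector at a time to the line of x0. A functional is kept as a linear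
    form in the coefficients; domination by the norm makes it well-defined on vectors. *)
Lemma norming_values_seq (T : eqType) (x0 : X) (x : T -> X) (r : seq T) :
  uniq r -> exists g : T -> R, forall (c : R) (a : T -> R),
    c * `|x0| + \sum_(i <- r) a i * g i <= `|c *: x0 + \sum_(i <- r) a i *: x i|.
Proof.
elim: r => [_|j r IHr /= /andP[j_notin /IHr[g g_le]]].
  exists (fun=> 0) => c a; rewrite !big_nil !addr0 normrZ ler_wpM2r //.
  exact: ler_norm.
pose G (c : R) (a : T -> R) := c * `|x0| + \sum_(i <- r) a i * g i.
pose V (c : R) (a : T -> R) := c *: x0 + \sum_(i <- r) a i *: x i.
have GD c a c' a' : G c a + G c' a' = G (c + c') (a \+ a').
  rewrite /G addrACA -mulrDl -big_split /=; congr (_ + _).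
  by apply: eq_bigr => i _; rewrite -mulrDl.
have VD c a c' a' : V c a + V c' a' = V (c + c') (a \+ a').
  rewrite /V addrACA -scalerDl -big_split /=; congr (_ + _).
  by apply: eq_bigr => i _; rewrite -scalerDl.
have GZ s c a : s * G c a = G (s * c) (fun i => s * a i).
  rewrite /G mulrDr mulr_sumr mulrA; congr (_ + _).
  by apply: eq_bigr => i _; rewrite mulrA.
have VZ s c a : s *: V c a = V (s * c) (fun i => s * a i).
  rewrite /V scalerDr scaler_sumr scalerA; congr (_ + _).
  by apply: eq_bigr => i _; rewrite scalerA.
have G_le c a : G c a <= `|V c a| by exact: g_le.
(* The value t at x j must satisfy G - |V - x j| <= t and t <= |V + x j| - G for all combinations.
   [S] collects the lower bounds, and its supremum is taken. *)
pose S := [set t | exists c a, t = G c a - `|V c a - x j|].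
have S_ub c a : ubound S (`|V c a + x j| - G c a).
  move=> _ [c' [a' ->]]; rewrite lerBlDr addrAC lerBrDr GD.
  apply: le_trans (G_le _ _) _; rewrite -VD.
  have -> : V c' a' + V c a = (V c a + x j) + (V c' a' - x j).
    by rewrite addrC [RHS]addrACA subrr addr0.
  exact: ler_normD.
have S_sup : has_sup S.
  split; first by exists (G 0 (fun=> 0) - `|V 0 (fun=> 0) - x j|), 0, (fun=> 0).
  by exists (`|V 0 (fun=> 0) + x j| - G 0 (fun=> 0)); exact: S_ub.
pose t := sup S.
have le_t c a : t <= `|V c a + x j| - G c a by exact: (ge_sup S_sup.1 (S_ub c a)).
have t_ge c a : G c a - `|V c a - x j| <= t.
  by apply: (ub_le_sup S_sup.2); exists c, a.
have step s c a : s * t + G c a <= `|s *: x j + V c a|.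
  have [s_gt0|s_lt0|->] := ltrgt0P s; last by rewrite mul0r scale0r !add0r.
  - have := le_t (s^-1 * c) (fun i => s^-1 * a i).
    rewrite -GZ -VZ -(ler_pM2l s_gt0) mulrBr mulVKf ?gt_eqF //.
    rewrite -[X in _ <= X * _ - _](gtr0_norm s_gt0) -normrZ scalerDr scalerA.
    rewrite mulfV ?gt_eqF //.
    by rewrite scale1r [V c a + _]addrC; lra.
  - have s'_gt0 : 0 < - s by rewrite oppr_gt0.
    have := t_ge ((- s)^-1 * c) (fun i => (- s)^-1 * a i).
    rewrite -GZ -VZ -(ler_pM2l s'_gt0) mulrBr mulVKf ?gt_eqF //.
    rewrite -[X in _ - X * _ <= _](gtr0_norm s'_gt0) -normrZ scalerBr scalerA.
    rewrite mulfV ?gt_eqF //.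
    by rewrite scale1r scaleNr opprK [V c a + _]addrC; lra.
exists (fun i => if i == j then t else g i) => c a.
rewrite !big_cons eqxx addrCA [X in _ <= `|X|]addrCA.
rewrite (_ : \sum_(i <- r) _ = \sum_(i <- r) a i * g i); first exact: step.
apply: eq_big_seq => i i_in; case: eqP => // ij.
by rewrite ij (negPf j_notin) in i_in.
Qed.

(* Hahn-Banach for finitely many vectors: g t is the value at x t of a functional
   of norm at most 1 that norms x i. *)
Lemma norming_values (T : finType) (x : T -> X) (i : T) :
  exists g : T -> R, g i = `|x i| /\
    forall a : T -> R, `|\sum_t a t * g t| <= `|\sum_t a t *: x t|.
Proof.
have [g g_le] := norming_values_seq (x i) x (index_enum_uniq T).
have g_le0 a : \sum_t a t * g t <= `|\sum_t a t *: x t|.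
  by have := g_le 0 a; rewrite mul0r scale0r !add0r.
exists g; split.
  apply/eqP; rewrite eq_le; apply/andP; split.
    have := g_le0 (fun t => (t == i)%:R).
    rewrite (bigD1 i) // [X in _ <= `|X|](bigD1 i) //= eqxx mul1r scale1r.
    rewrite !big1 ?addr0 // => j /negPf ->; by rewrite ?mul0r ?scale0r.
  have := g_le 1 (fun t => - (t == i)%:R).
  rewrite (bigD1 i) // [X in _ <= `|_ + X|](bigD1 i) //= eqxx mul1r scale1r.
  rewrite !big1 ?addr0 => [|j /negPf ->|j /negPf ->]; last 2 first.
  - by rewrite oppr0 scale0r.
  - by rewrite oppr0 mul0r.
  by rewrite mulN1r scaleN1r subrr normr0 subr_le0.
move=> a; rewrite ler_norml g_le0 andbT lerNl -sumrN.
have := g_le0 (fun t => - a t).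
under eq_bigr do rewrite mulNr.
under [X in _ <= `|X|]eq_bigr do rewrite scaleNr.
by rewrite [X in _ <= `|X|]sumrN normrN.
Qed.

End Norming.

(** * Greedy selection and the number of large vectors *)

(** Each pick i discards the at most m elements j with e i j, so that q m elements allow q picks. As
    e need not be symmetric, only pairs in the order of picking are controlled. *)
Lemma greedy_seq (T : finType) (e : rel T) (m q : nat) (I : {set T}) :
    (0 < m)%N -> {in I, forall i, e i i} ->
    {in I, forall i, #|[set j in I | e i j]| <= m}%N -> (q * m <= #|I|)%N ->
  exists s : seq T, [/\ size s = q, {subset s <= I} & pairwise (fun i j => ~~ e i j) s].
Proof.
move=> m_gt0; elim: q I => [|q IHq] I e_refl e_le le_I; first by exists [::].
have [i Ii] : exists i, i \in I.
  by apply/card_gt0P; apply: leq_trans le_I; rewrite muln_gt0.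
pose I' := [set j in I | ~~ e i j].
have sub_I : I' \subset I by apply/fintype.subsetP => j; rewrite inE => /andP[].
have [j Ij|j Ij||s [sz_s s_sub s_pw]] := IHq I'.
- by apply: e_refl; apply: fintype.subsetP Ij.
- apply: leq_trans (e_le j (fintype.subsetP sub_I _ Ij)); apply: subset_leq_card.
  by apply/fintype.subsetP => k; rewrite !inE => /andP[/andP[-> _] ->].
- have := cardsID [set j | e i j] I.
  have -> : I :\: [set j | e i j] = I' by apply/finset.setP => k; rewrite !inE andbC.
  have -> : I :&: [set j | e i j] = [set j in I | e i j].
    by apply/finset.setP => k; rewrite !inE.
  have := e_le i Ii; move: le_I; rewrite mulSn; lia.
exists (i :: s); split => /=; first by rewrite sz_s.
  by move=> k; rewrite inE => /orP[/eqP -> //|/s_sub]; apply: (fintype.subsetP sub_I).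
rewrite s_pw andbT; apply/allP => k /s_sub; by rewrite inE => /andP[].
Qed.

Section LargeVectors.
Context {R : realType} {X : normedModType R}.

(* The y of separated_card are the sums of one vector from each of s blocks of q
   consecutive vectors of the greedy sequence. *)
Lemma large_vectors_card d (v : 'I_d -> X) (T : finType) (x : T -> X)
    (m s q K : nat) (beta B : R) (I : {set T}) :
    lin_indep v -> (forall t, lin_span v (x t)) ->
    (0 < m)%N -> (0 < s)%N -> (0 < K)%N -> 0 < beta ->
    (forall t, `|x t| <= B) -> 8 * s%:R * B <= K%:R * beta ->
    (forall (A : {set T}) (eps : T -> bool), #|A| = m ->
      `|\sum_(t in A) (-1) ^+ eps t *: x t| <= beta / (4 * s%:R) * m%:R) ->
    {in I, forall t, beta <= `|x t|} -> (q * s * m <= #|I|)%N ->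
  (q ^ s <= K.+1 ^ d)%N.
Proof.
move=> indep_v x_span m_gt0 s_gt0 K_gt0 beta_gt0 x_le le_K sign_le I_large le_I.
have [g gP] := choice (norming_values x).
have s_ge1 : 1 <= s%:R :> R by rewrite ler1n.
have [tau tau_gt0 tauE] : exists2 tau : R, 0 < tau & beta = 4 * s%:R * tau.
  exists (beta / (4 * s%:R)); first by rewrite divr_gt0 // mulr_gt0 // ltr0n.
  by rewrite mulrC divfK // mulf_neq0 // ?pnatr_eq0 -?lt0n.
have {}sign_le (A : {set T}) (eps : T -> bool) : #|A| = m ->
    `|\sum_(t in A) (-1) ^+ eps t *: x t| <= tau * m%:R.
  move=> /sign_le /le_trans; apply; rewrite ler_wpM2r // tauE mulrAC.
  by rewrite mulfV ?mul1r // mulf_neq0 // pnatr_eq0 -lt0n.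
have tau_lt : tau < beta by rewrite tauE; nra.
pose e (i j : T) := tau < `|g i j|.
have e_refl : {in I, forall i, e i i}.
  by move=> i Ii; rewrite /e (gP i).1 normr_id (lt_le_trans tau_lt) // I_large.
(* Otherwise the sum of m such vectors, with the signs of the values of g i, would have norm larger
   than tau m. *)
have e_le : {in I, forall i, #|[set j in I | e i j]| <= m}%N.
  move=> i _; rewrite leqNgt; apply/negP => lt_m.
  pose A := [set t in take m (enum [set j in I | e i j])].
  have card_A : #|A| = m.
    by rewrite cardsE (card_uniqP _) ?take_uniq ?enum_uniq // size_take -cardE lt_m.
  have A_large t : t \in A -> tau < `|g i t|.
    by rewrite inE => /mem_take; rewrite mem_enum inE => /andP[].
  pose eps t := g i t < 0.
  have := (gP i).2 (fun t => if t \in A then (-1) ^+ eps t else 0).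
  have -> : \sum_t (if t \in A then (-1) ^+ eps t else 0) *: x t =
      \sum_(t in A) (-1) ^+ eps t *: x t.
    rewrite [RHS]big_mkcond; apply: eq_bigr => t _.
    by case: ifP => // _; rewrite scale0r.
  have -> : \sum_t (if t \in A then (-1) ^+ eps t else 0) * g i t =
      \sum_(t in A) `|g i t|.
    rewrite [RHS]big_mkcond; apply: eq_bigr => t _.
    by case: ifP => _; rewrite ?mul0r // /eps -normrEsign.
  move=> /le_trans /(_ (sign_le A eps card_A)).
  rewrite ger0_norm ?sumr_ge0 // leNgt => /negP; apply.
  rewrite mulr_natr -card_A -sumr_const; apply: ltr_sum => //.
  have /card_gt0P[t At] : (0 < #|A|)%N by rewrite card_A.
  by apply/hasP; exists t; rewrite ?mem_index_enum.
have [r [sz_r r_sub r_pw]] := greedy_seq m_gt0 e_refl e_le le_I.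
have [->|q_gt0] := posnP q; first by rewrite exp0n.
have [t0 _] : exists t0, t0 \in r.
  case: r sz_r {r_sub r_pw} => [|t0 r _]; last by exists t0; rewrite mem_head.
  by move/eqP; rewrite eq_sym muln_eq0 !gtn_eqF.
pose idx (l : 'I_s) (c : 'I_q) := nth t0 r (l * q + c).
have pos_lt (l : 'I_s) (c : 'I_q) : (l * q + c < size r)%N.
  rewrite sz_r; have := ltn_ord l; have := ltn_ord c; nia.
have idx_I l c : idx l c \in I by apply: r_sub; rewrite mem_nth.
have idx_small (l l' : 'I_s) (c c' : 'I_q) : (l * q + c < l' * q + c')%N ->
    `|g (idx l c) (idx l' c')| <= tau.
  move=> lt_pos; rewrite leNgt.
  have /(pairwiseP t0) pw := r_pw.
  exact: (pw _ _ (pos_lt l c) (pos_lt l' c') lt_pos).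
pose Y (w : {ffun 'I_s -> 'I_q}) := \sum_l x (idx l (w l)).
have g_diff i (w w' : {ffun 'I_s -> 'I_q}) :
    `|\sum_l (g i (idx l (w l)) - g i (idx l (w' l)))| <= `|Y w - Y w'|.
  have := (gP i).2 (fun t => \sum_l ((idx l (w l) == t)%:R - (idx l (w' l) == t)%:R)).
  have delta (U : lmodType R) (h : T -> U) t : \sum_u (t == u)%:R *: h u = h t.
    rewrite (bigD1 t) //= eqxx scale1r big1 ?addr0 // => u.
    by rewrite eq_sym => /negPf ->; rewrite scale0r.
  have sumE (U : lmodType R) (h : T -> U) :
      \sum_t (\sum_l ((idx l (w l) == t)%:R - (idx l (w' l) == t)%:R)) *: h t =
      \sum_l (h (idx l (w l)) - h (idx l (w' l))).
    under eq_bigr do rewrite scaler_suml.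
    rewrite exchange_big; apply: eq_bigr => l _ /=.
    under eq_bigr do rewrite scalerBl.
    by rewrite sumrB !delta.
  by rewrite (sumE X) (sumE R^o (g i)) [X in _ <= `|X|]sumrB.
(* At the first block l where the choices differ, let i be the earlier of the two vectors. The
   functional norming i is at least beta at i and at most tau in modulus at the other vectors that
   do not cancel, all of them later. This separates the sums by beta - 2 s tau = beta / 2. *)
have sep (w w' : {ffun 'I_s -> 'I_q}) (l : 'I_s) :
    (forall l' : 'I_s, (l' < l)%N -> w l' = w' l') -> (w l < w' l)%N ->
    beta / 2 <= `|Y w - Y w'|.
  move=> eq_w lt_w; apply: le_trans (g_diff (idx l (w l)) w w').
  apply: le_trans (ler_norm _).
  pose i := idx l (w l).
  pose D l' := if l' == l then - g i (idx l (w' l))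
    else g i (idx l' (w l')) - g i (idx l' (w' l')).
  have -> : \sum_l' (g i (idx l' (w l')) - g i (idx l' (w' l'))) =
      g i i + \sum_l' D l'.
    rewrite (bigD1 l) //= [in RHS](bigD1 l) //= {1}/D eqxx addrA; congr (_ + _).
    by apply: eq_bigr => l' /negPf neq_l; rewrite /D neq_l.
  have D_le l' : `|D l'| <= 2 * tau.
    have pos_small (l1 : 'I_s) (c : 'I_q) : (l < l1)%N -> `|g i (idx l1 c)| <= tau.
      move=> lt_l; apply: idx_small; have := ltn_ord (w l); nia.
    rewrite /D; case: eqP => [_|/eqP neq_l].
      rewrite normrN; apply: le_trans (_ : tau <= _); last by lra.
      by apply: idx_small; rewrite ltn_add2l.
    have [lt_l|lt_l|/val_inj eq_l] := ltngtP l' l.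
    - by rewrite eq_w // subrr normr0; lra.
    - apply: le_trans (ler_normB _ _) _.
      by have := pos_small _ (w l') lt_l; have := pos_small _ (w' l') lt_l; lra.
    - by rewrite eq_l eqxx in neq_l.
  have : `|\sum_l' D l'| <= s%:R * (2 * tau).
    apply: le_trans (ler_norm_sum _ _ _) _.
    apply: le_trans (ler_sum _ (fun l' _ => D_le l')) _.
    by rewrite sumr_const card_ord -[X in X <= _]mulr_natl.
  have : beta <= g i i by rewrite (gP i).1; apply: I_large; exact: idx_I.
  rewrite ler_norml; move: tauE; lra.
have -> : (q ^ s = #|{ffun 'I_s -> 'I_q}|)%N by rewrite card_ffun !card_ord.
apply: (separated_card (rho := beta / 2) (r0 := s%:R * B) (y := Y) indep_v) => //.
- move=> w; have [a aE] := choice x_span.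
  exists (fun j => \sum_l a (idx l (w l)) j).
  under [RHS]eq_bigr do rewrite scaler_suml.
  by rewrite exchange_big; apply: eq_bigr => l _; rewrite -aE.
- by rewrite divr_gt0.
- by lra.
- move=> w; apply: le_trans (ler_norm_sum _ _ _) _.
  apply: le_trans (ler_sum _ (fun l _ => x_le _)) _.
  by rewrite sumr_const card_ord -[X in X <= _]mulr_natl.
- move=> w w' neq_w.
  have [l0 neq_l0] : exists l, w l != w' l.
    apply/existsP; rewrite -negb_forall; apply: contra neq_w => /forallP eq_w.
    by apply/eqP/ffunP => l; apply/eqP.
  case: (@arg_minnP _ l0 (fun l => w l != w' l) (fun l : 'I_s => l : nat) neq_l0).
  move=> l neq_l min_l.
  have eq_lt (l' : 'I_s) : (l' < l)%N -> w l' = w' l'.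
    by move=> lt_l; apply/eqP; apply: contraTT lt_l => /min_l; rewrite leqNgt.
  have [lt_w|lt_w|/val_inj eq_w] := ltngtP (w l) (w' l).
  + exact: sep eq_lt lt_w.
  + by rewrite distrC; apply: (sep _ _ l) => // l' /eq_lt ->.
  + by rewrite eq_w eqxx in neq_l.
Qed.

End LargeVectors.

(** * Coordinate functionals of a Schauder basis *)

Section SchauderBasis.
Context {R : realType} {Z : completeNormedModType R}.
Variable z : nat -> Z.
Hypothesis basis_z : schauder_basis z.

Lemma basis_coefs : exists c : Z -> nat -> R,
  (forall y, series (fun i => c y i *: z i) @ \oo --> y) /\
  (forall a y, series (fun i => a i *: z i) @ \oo --> y -> c y = a).
Proof.
have [c cP] := choice (fun y => basis_z y).
by exists c; split => [y|a y /(cP y).2]; first exact: (cP y).1.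
Qed.

Lemma basis_neq0 i : z i != 0.
Proof.
have [a [_ a_uniq]] := basis_z 0.
have zero_cvg (b : nat -> R) : (forall j, b j *: z j = 0) -> a = b.
  move=> b0; apply: a_uniq.
  have -> : series (fun j => b j *: z j) = cst 0.
    by apply/funext => n; rewrite /series /= big1.
  exact: cvg_cst.
apply/eqP => zi0.
have a0 : a = fun=> 0 by apply: zero_cvg => j; rewrite scale0r.
have a1 : a = fun j => (j == i)%:R.
  by apply: zero_cvg => j; case: eqP => [->|_]; rewrite ?zi0 ?scaler0 ?scale0r.
have := congr1 (fun g : nat -> R => g i) a1; rewrite a0 eqxx => /esym/eqP.
by rewrite oner_eq0.
Qed.

(** The partial sum operators [p] are not yet known to be continuous, so uniform boundedness cannot
    be quoted for them. Baire is applied to the closures of the sets [F m] where they are bounded by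
    m. *)
Lemma basis_coef_bound : exists2 K : R, 0 < K & forall (a : nat -> R) (y : Z) i,
  series (fun i => a i *: z i) @ \oo --> y -> `|a i| * `|z i| <= K * `|y|.
Proof.
have [c [c_cvg c_uniq]] := basis_coefs.
pose p y := series (fun i => c y i *: z i).
have cB u w i : c (u - w) i = c u i - c w i.
  have -> // : c (u - w) = fun i => c u i - c w i.
  apply: c_uniq; rewrite (_ : series _ = (fun n => p u n - p w n)).
    exact: (cvgB (c_cvg u) (c_cvg w)).
  apply/funext => n; rewrite /p /series /= -sumrB.
  by apply: eq_bigr => j _; rewrite scalerBl.
have cZ s u i : c (s *: u) i = s * c u i.
  have -> // : c (s *: u) = fun i => s * c u i.
  apply: c_uniq; rewrite (_ : series _ = (fun n => s *: p u n)).
    exact: (@cvgZl_tmp _ _ _ _ _ s _ _ (c_cvg u)).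
  apply/funext => n; rewrite /p /series /= scaler_sumr.
  by apply: eq_bigr => j _; rewrite scalerA.
have pB u w n : p (u - w) n = p u n - p w n.
  by rewrite /p /series /= -sumrB; apply: eq_bigr => j _; rewrite cB scalerBl.
have pZ s u n : p (s *: u) n = s *: p u n.
  by rewrite /p /series /= scaler_sumr; apply: eq_bigr => j _; rewrite cZ scalerA.
pose F (m : nat) := [set y | forall n, `|p y n| <= m%:R].
have F_cover y : exists m, F m y.
  have /cvgP/cvg_seq_bounded [B [_ B_le]] := c_cvg y.
  exists (Num.truncn (`|B| + 1)).+1 => n.
  apply: ltW; apply: le_lt_trans (truncnS_gt _); apply: B_le => //.
  by rewrite (le_lt_trans (ler_norm _)) // ltrDl.
(* Baire, then successive approximation as in the open mapping theorem: the
   remainders w j tend to 0 and their coefficients converge, necessarily to the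
   coefficients of 0. *)
have [m [W [nonempty_W open_W sub_W]]] : exists m W,
    [/\ W !=set0, open W & W `<=` closure (F m)].
  apply: contrapT => no_ball.
  have /Baire : forall m, open (~` closure (F m)) /\ dense (~` closure (F m)).
    move=> m; split; first by apply: closed_openC; exact: closed_closure.
    move=> W nonempty_W open_W; apply: contrapT => disj_W; apply: no_ball.
    exists m, W; split => // y W_in; apply: contrapT => ncl_y; apply: disj_W.
    by exists y.
  move=> /(_ setT) []; [by exists 0 | exact: openT |].
  move=> y [_ yF]; have [m Fmy] := F_cover y.
  by apply: (yF m I); exact: subset_closure.
have [y0 Wy0] := nonempty_W.
have [r r_gt0 ball_W] : exists2 r : R, 0 < r & forall y, `|y| < r -> W (y0 + y).
  have /nbhs_ballP[r /= r_gt0 r_sub] : nbhs y0 W by exact: open_nbhs_nbhs.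
  exists r => // y y_lt; apply: r_sub; rewrite -ball_normE /ball_ /=.
  by rewrite opprD addrA subrr sub0r normrN.
have F_near y eta : 0 < eta -> W y -> exists2 u, F m u & `|y - u| < eta.
  move=> eta_gt0 /sub_W /(_ _ (nbhsx_ballx y eta eta_gt0)) [u [Fu]].
  by rewrite -ball_normE; exists u.
have [kappa kappa_ge0 kappaE] : exists2 k : R, 0 <= k & k = 4 * m%:R / r.
  by eexists; last reflexivity; rewrite divr_ge0 ?mulr_ge0 // ltW.
have approx y eta : 0 < eta ->
    exists u, `|y - u| <= eta /\ forall n, `|p u n| <= kappa * `|y|.
  move=> eta_gt0; have [->|y_neq0] := eqVneq y 0.
    exists 0; split; first by rewrite subrr normr0 ltW.
    by move=> n; have := pZ 0 0 n; rewrite !scale0r => ->; rewrite normr0 mulr0.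
  have y_gt0 : 0 < `|y| by rewrite normr_gt0.
  (* Since s y has norm r/2, both y0 and y0 + s y lie in W. A difference of two points of [F m] has
     partial sums of norm at most 2 m, and 2 m / s = kappa |y|. *)
  pose s := r / (2 * `|y|).
  have s_gt0 : 0 < s by rewrite divr_gt0 // mulr_gt0.
  have Wy : W (y0 + s *: y).
    apply: ball_W; rewrite normrZ gtr0_norm // /s invfM mulrA divfK ?gt_eqF //.
    by rewrite ltr_pdivrMr // ltr_pMr // ltr1n.
  have eta'_gt0 : 0 < s * eta / 2 by rewrite divr_gt0 // mulr_gt0.
  have [u1 Fu1 u1_near] := F_near _ _ eta'_gt0 Wy.
  have [u0 Fu0 u0_near] := F_near _ _ eta'_gt0 Wy0.
  exists (s^-1 *: (u1 - u0)); split.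
    have -> : y - s^-1 *: (u1 - u0) = s^-1 *: ((y0 + s *: y - u1) - (y0 - u0)).
      have -> : y0 + s *: y - u1 - (y0 - u0) = s *: y - (u1 - u0).
        by rewrite opprB addrC -[y0 + _ - _]addrA addrA subrK opprB addrCA.
      by rewrite [RHS]scalerBr scalerA mulVf ?scale1r ?gt_eqF.
    rewrite normrZ gtr0_norm ?invr_gt0 // mulrC ler_pdivrMr //.
    by apply: le_trans (ler_normB _ _) _; lra.
  move=> n; rewrite pZ pB normrZ gtr0_norm ?invr_gt0 // mulrC ler_pdivrMr //.
  apply: le_trans (ler_normB _ _) _.
  have -> : kappa * `|y| * s = 2 * m%:R by rewrite kappaE /s; field; rewrite !gt_eqF.
  by have := Fu1 n; have := Fu0 n; lra.
suff bound y i : `|c y i| * `|z i| <= 4 * kappa * `|y|.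
  exists (4 * kappa + 1); first by rewrite ltr_wpDl // mulr_ge0.
  move=> a y i /c_uniq <-; apply: le_trans (bound y i) _.
  by rewrite ler_wpM2r // lerDl.
have c0 j : c 0 j = 0 by have := cZ 0 0 j; rewrite scale0r mul0r.
have [->|y_neq0] := eqVneq y 0; first by rewrite c0 !normr0 mul0r mulr0.
pose N := `|y|; have N_gt0 : 0 < N by rewrite normr_gt0.
pose eta j : R := 2^-1 ^+ j * N.
have eta_gt0 j : 0 < eta j by rewrite mulr_gt0 // exprn_gt0.
have etaS j : eta j = 2 * eta j.+1 by rewrite /eta exprS; field.
have [U UP] := choice (fun yj : Z * nat => approx yj.1 _ (eta_gt0 yj.2.+1)).
pose w := fix w j := if j is k.+1 then w k - U (w k, k) else y.
have w_le j : `|w j| <= eta j.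
  by case: j => [|j]; [rewrite /eta expr0 mul1r | exact: (UP (w j, j)).1].
have w_step j n : `|p (w j) n - p (w j.+1) n| <= kappa * eta j.
  rewrite -pB /= opprB addrC subrK.
  by apply: le_trans ((UP (w j, j)).2 n) _; rewrite ler_wpM2l // w_le.
have w_tail j k n : `|p (w j) n - p (w (j + k)%N) n| <= 2 * kappa * eta j.
  suff : `|p (w j) n - p (w (j + k)%N) n| <= 2 * kappa * (eta j - eta (j + k)%N).
    move=> /le_trans; apply; rewrite ler_wpM2l ?mulr_ge0 //.
    by rewrite gerBl ltW.
  elim: k => [|k IHk]; first by rewrite addn0 !subrr normr0 mulr0.
  rewrite addnS; apply: le_trans (ler_distD (p (w (j + k)%N) n) _ _) _.
  apply: le_trans (lerD IHk (w_step _ _)) _.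
  by rewrite [eta (j + k)%N]etaS; lra.
have coefE u j : c u j *: z j = p u j.+1 - p u j.
  by rewrite /p /series /= big_nat_recr //= [RHS]addrC addKr.
have z_gt0 j : 0 < `|z j| by rewrite normr_gt0 basis_neq0.
have cvg_w j : cvgn (fun k => c (w k) j).
  pose d k := c (w k) j - c (w k.+1) j.
  have d_le k : `|d k| <= 2 * kappa * N / `|z j| * 2^-1 ^+ k.
    rewrite -(ler_pM2r (z_gt0 j)) -normrZ scalerBl !coefE.
    rewrite opprD opprK addrACA [- _ + _]addrC -[p (w k.+1) j - _]opprB.
    apply: le_trans (ler_normB _ _) _.
    apply: le_trans (lerD (w_step _ _) (w_step _ _)) _.
    rewrite le_eqVlt; apply/orP; left; apply/eqP; rewrite /eta; field.
    by rewrite gt_eqF.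
  have -> : (fun k => c (w k) j) = (fun k => c (w 0%N) j - series d k).
    apply/funext => k; rewrite /series /=; elim: k => [|k IHk].
      by rewrite big_geq // subr0.
    by rewrite big_nat_recr //= opprD addrA -IHk /d opprB addrC subrK.
  apply: is_cvgB; first exact: is_cvg_cst.
  apply: normed_cvg.
  apply: (@series_le_cvg _ _ (geometric (2 * kappa * N / `|z j|) 2^-1)) => //.
  - by move=> k; exact: normr_ge0.
  - by move=> k; apply: le_trans (d_le k).
  - by apply: is_cvg_geometric_series; rewrite ger0_norm // invf_lt1 // ltr1n.
pose e j := limn (fun k => c (w k) j).
pose q := series (fun j => e j *: z j).
have cvg_q n : (fun k => p (w k) n) @ \oo --> q n.
  rewrite /p /q /series /=.
  apply: (@cvg_big Z _ _ _ _ (@add_continuous Z)) => j _.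
  by apply: cvgZr_tmp; exact: cvg_w.
have q_near j n : `|p (w j) n - q n| <= 2 * kappa * eta j.
  apply/ler_addgt0Pr => eps eps_gt0.
  have /cvgrPdist_le /(_ _ eps_gt0) [k0 _ k0_le] := cvg_q n.
  apply: le_trans (ler_distD (p (w (j + k0)%N) n) _ _) _.
  apply: lerD; first exact: w_tail.
  by rewrite distrC; apply: k0_le; rewrite /= leq_addl.
(* For fixed j, q n is within 2 kappa eta_j of p (w j) n, which tends to w j, of norm at most eta_j.
   So q tends to 0, and its coefficients are those of 0; then [q_near] at w 0 = y bounds the partial
   sums of y. *)
have q_cvg0 : q @ \oo --> 0.
  apply/cvgrPdist_le => eps eps_gt0.
  have [j j_le] : exists j, (2 * kappa + 1) * eta j <= eps / 2.
    pose x := (2 * kappa + 1) * N * 2 / eps; exists (Num.truncn x).+1.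
    have : x < 2 ^+ (Num.truncn x).+1.
      apply: lt_le_trans (truncnS_gt x) _.
      by rewrite -natrX ler_nat ltnW // ltn_expl.
    rewrite {1}/x ltr_pdivrMr // /eta exprVn => /ltW x_le.
    rewrite mulrCA mulrC ler_pdivrMr ?exprn_gt0 //; lra.
  have /cvgrPdist_le /(_ _ (divr_gt0 eps_gt0 (ltr0n _ 2))) [n0 _ n0_le] := c_cvg (w j).
  exists n0 => // n le_n; rewrite sub0r normrN.
  have := n0_le n le_n; have := w_le j; have := q_near j n.
  have := ler_normD (q n - p (w j) n) (p (w j) n); rewrite subrK (distrC (q n)).
  have := ler_normD (p (w j) n - w j) (w j); rewrite subrK (distrC _ (w j)) -/(p (w j)).
  by lra.
have q0 n : q n = 0.
  by rewrite /q /series /= -(c_uniq _ _ q_cvg0) big1 // => j _; rewrite c0 scale0r.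
have p_le n : `|p y n| <= 2 * kappa * N.
  by have := q_near 0%N n; rewrite q0 subr0 /eta expr0 mul1r.
rewrite -normrZ coefE; apply: le_trans (ler_normB _ _) _.
by have := p_le i; have := p_le i.+1; rewrite -/N; lra.
Qed.

End SchauderBasis.

(** * Bounded operators and the dimensions of the ranges *)

Lemma opnorm_bound (R : realType) (X Y : normedModType R) (T : {linear X -> Y}) u :
  continuous T -> `|T u| <= opnorm T * `|u|.
Proof.
move=> /linear_bounded_continuous /linear_boundedP T_bounded.
have [B B_gt0 T_le] : exists2 B : R, 0 < B & forall w, `|T w| <= B * `|w|.
  have [B0 [_ B0_le]] := T_bounded.
  exists (`|B0| + 1) => [|w]; first by rewrite ltr_wpDl.
  by apply: B0_le; rewrite (le_lt_trans (ler_norm _)) // ltrDl.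
have [->|u_neq0] := eqVneq u 0; first by rewrite linear0 !normr0 mulr0.
have u_gt0 : 0 < `|u| by rewrite normr_gt0.
rewrite -ler_pdivrMr //; apply: ub_le_sup.
  exists B => _ [w /= w_le <-]; apply: le_trans (T_le w) _.
  by rewrite ler_piMr // ltW.
exists (`|u|^-1 *: u).
  by rewrite /= normrZ normfV normr_id mulVf ?gt_eqF.
by rewrite linearZ normrZ normfV normr_id mulrC.
Qed.

(** For large n the P_n v_i are within t of D independent vectors v_i. A vanishing combination of
    them has b |a_i| <= t sum |a_j|; summing over i, with D t <= b/2, gives a = 0. *)
Lemma lin_dim_range_unbounded (R : realType) (X : normedModType R)
    (P : nat -> {linear X -> X}) (D : nat) :
    ~ finite_dim [set: X] -> (forall n, finite_rank_projection (P n)) ->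
    (forall u : X, P n u @[n --> \oo] --> u) ->
  \forall n \near \oo, (D <= lin_dim (range (P n)))%N.
Proof.
move=> infX projP approxP.
have [v indep_v] := lin_indep_exists D infX.
have [b b_gt0 b_le] := lin_indep_lower_bound indep_v.
pose t := b / (2 * D.+1%:R).
have t_gt0 : 0 < t by rewrite divr_gt0 // mulr_gt0.
have near_v : \forall n \near \oo, forall i, `|v i - P n (v i)| <= t.
  apply: filter_forall => i.
  by have /cvgrPdist_le /(_ _ t_gt0) := approxP (v i).
near=> n.
have Pv_le : forall i, `|v i - P n (v i)| <= t by near: n; exact: near_v.
have [_ _ [e dim_e]] := projP n.
rewrite (lin_dimE dim_e).
apply: (lin_indep_span_dim (v := fun i => P n (v i)) _ _ dim_e); last first.
  by move=> i; exists (v i).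
move=> a sum0.
have a_le i : b * `|a i| <= t * \sum_j `|a j|.
  apply: le_trans (b_le a i) _.
  have -> : \sum_j a j *: v j = \sum_j a j *: (v j - P n (v j)).
    by under [RHS]eq_bigr do rewrite scalerBr; rewrite sumrB sum0 subr0.
  apply: le_trans (ler_norm_sum _ _ _) _; rewrite mulr_sumr; apply: ler_sum => j _.
  by rewrite normrZ mulrC ler_wpM2r.
have sum_le : b * \sum_j `|a j| <= (b / 2) * \sum_j `|a j|.
  rewrite mulr_sumr; apply: le_trans (ler_sum _ (fun j _ => a_le j)) _.
  rewrite sumr_const card_ord -[X in X <= _]mulr_natl mulrA ler_wpM2r ?sumr_ge0 //.
  have : t * (2 * (D%:R + 1)) = b.
    by rewrite natr1 divfK // mulf_neq0 // pnatr_eq0.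
  by lra.
have sum_eq0 : \sum_j `|a j| = 0.
  have : 0 <= \sum_j `|a j| by exact: sumr_ge0.
  by nra.
move=> i; apply/eqP; rewrite -normr_eq0 eq_le normr_ge0 andbT -sum_eq0.
by rewrite (bigD1 i) //= lerDl sumr_ge0.
Unshelve. all: by end_near. Qed.

(** * Integer combinations under the lower estimate *)

(** Passage from combinations indexed by ['I_M] to the finite sets of naturals in [lower_norms] and
    [sign_norms]. *)
Lemma ord_set_fset M (S : {set 'I_M}) : exists A : {fset nat},
  [/\ #|` A| = #|S|, forall j, j \in A -> exists2 i, i \in S & j = val i &
    forall (V : nmodType) (F : nat -> V), \sum_(j <- A) F j = \sum_(i in S) F i].
Proof.
pose s := [seq val i | i <- enum S].
have s_uniq : uniq s by rewrite map_inj_uniq ?enum_uniq //; exact: val_inj.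
have A_perm : perm_eq [fset j in s]%fset s.
  by apply: uniq_perm => // j; rewrite inE.
exists [fset j in s]%fset; split.
- by rewrite (perm_size A_perm) size_map -cardE.
- by move=> j; rewrite inE => /mapP[i]; rewrite mem_enum => Si ->; exists i.
- by move=> V F; rewrite (perm_big _ A_perm) big_map big_enum.
Qed.

Section LowerEstimate.
Context {R : realType} {Z : completeNormedModType R}.
Variable z : nat -> Z.
Hypothesis lower_z : inf (lower_norms z n) @[n --> \oo] --> +oo.

Lemma lower_norms_inf (A : {fset nat}) (k : nat -> int) :
    (forall j, j \in A -> k j != 0) ->
  inf (lower_norms z #|` A|) <= `|\sum_(j <- A) (k j)%:~R *: z j|.
Proof.
move=> k_neq0; apply: ge_inf; last by exists A, k.
by exists 0 => _ [A' [k' [_ _ ->]]]; exact: normr_ge0.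
Qed.

Lemma support_bound (C : R) : exists L : nat, forall (A : {fset nat}) (k : nat -> int),
    (forall j, j \in A -> k j != 0) ->
    `|\sum_(j <- A) (k j)%:~R *: z j| <= C -> (#|` A| <= L)%N.
Proof.
have /cvgryPgt /(_ C) [L _ L_lt] := lower_z.
exists L => A k k_neq0 le_C; rewrite leqNgt; apply/negP => /ltnW /L_lt /=.
by apply/negP; rewrite -leNgt (le_trans (lower_norms_inf k_neq0)).
Qed.

(** If infinitely many z_i had norm below 1/(L+1), some L + 1 of them would have a sum of norm at
    most 1, against [support_bound]. The finitely many exceptions are nonzero. *)
Lemma basis_norm_lower_bound : schauder_basis z ->
  exists2 c : R, 0 < c & forall i, c <= `|z i|.
Proof.
move=> basis_z.
have [L support_le] := support_bound 1.
pose small i := `|z i| < L.+1%:R^-1.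
have [N N_large] : exists N, forall i, (N <= i)%N -> ~~ small i.
  apply: contrapT => /forallNP unbounded.
  have extend m : exists A : {fset nat}, #|` A| = m /\ forall j, j \in A -> small j.
    elim: m => [|m [A [card_A A_small]]]; first by exists fset0; rewrite cardfs0.
    have [i lt_i small_i] : exists2 i, (\max_(j <- A) j < i)%N & small i.
      apply: contrapT => no_i; apply: (unbounded (\max_(j <- A) j).+1) => i lt_i.
      by apply/negP => small_i; apply: no_i; exists i.
    exists (i |` A)%fset; split => [|j].
      rewrite cardfsU1 card_A; case: (boolP (i \in A)) => // Ai.
      have : (i <= \max_(j <- A) j)%N by apply: (leq_bigmax_seq (F := id)).
      by rewrite leqNgt lt_i.
    by rewrite !inE => /orP[/eqP -> //|/A_small].
  have [A [card_A A_small]] := extend L.+1.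
  suff : (#|` A| <= L)%N by rewrite card_A ltnn.
  apply: (support_le A (fun=> 1)) => //.
  apply: le_trans (ler_norm_sum _ _ _) _.
  apply: (@le_trans _ _ (\sum_(j <- A) L.+1%:R^-1)).
    by rewrite big_seq [leRHS]big_seq ler_sum // => j /A_small /ltW; rewrite scale1r.
  rewrite big_const_seq count_predT iter_addr_0 card_A.
  by rewrite -[X in X <= _]mulr_natr mulVf // pnatr_eq0.
exists (\big[Num.min/L.+1%:R^-1]_(i < N) `|z i|) => [|i].
  by apply/lt_bigmin => // i _; rewrite normr_gt0 basis_neq0.
have [lt_i|le_i] := ltnP i N; first exact: (bigmin_le _ (Ordinal lt_i)).
by apply: le_trans (bigmin_le_id _ _ _ _) _; rewrite leNgt N_large.
Qed.

Lemma small_norm_coefs (delta C : R) : schauder_basis z -> 0 < delta ->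
  exists L B : nat, forall M (k : 'I_M -> int),
    `|\sum_(i < M) ((k i)%:~R * delta) *: z i| <= C ->
    (#|[set i | k i != 0%R]%SET| <= L)%N /\ forall i, (`|k i|%N <= B)%N.
Proof.
move=> basis_z delta_gt0.
have [L support_le] := support_bound (C / delta).
have [K K_gt0 coef_le] := basis_coef_bound basis_z.
have [c c_gt0 z_ge] := basis_norm_lower_bound basis_z.
(* The second bound comes from |k_i| delta c <= |k_i delta| |z_i| <= K C. *)
exists L, (Num.truncn (K * C / (c * delta))) => M k k_le.
split.
  have [A [<- A_sub A_sum]] := ord_set_fset [set i | k i != 0]%SET.
  pose k' j := oapp k 0 (insub j).
  apply: (support_le A k') => [j /A_sub[i]|].
    by rewrite inE => ki_neq0 ->; rewrite /k' valK.
  rewrite A_sum ler_pdivlMr // -[X in _ * X](gtr0_norm delta_gt0) mulrC -normrZ.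
  apply: le_trans k_le; rewrite scaler_sumr.
  rewrite [in leRHS](bigID (mem [set i | k i != 0]%SET)) /=.
  rewrite [X in _ <= `|_ + X|]big1 ?addr0 => [|i]; last first.
    by rewrite inE negbK => /eqP ->; rewrite mul0r scale0r.
  rewrite le_eqVlt; apply/orP; left; apply/eqP; congr `|_|.
  by apply: eq_bigr => i _; rewrite /k' valK /= scalerA mulrC.
move=> i.
pose a j : R := oapp (fun i : 'I_M => (k i)%:~R * delta) 0 (insub j).
have a_cvg : series (fun j => a j *: z j) @ \oo -->
    \sum_(i < M) ((k i)%:~R * delta) *: z i.
  apply: cvg_near_cst; exists M => // n /= le_n.
  rewrite /series /= (big_cat_nat (leq0n M) le_n) /= [X in _ + X]big_nat_cond.
  rewrite [X in _ + X]big1 ?addr0.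
    by rewrite big_mkord; apply: eq_bigr => j _; rewrite /a valK.
  by move=> j /andP[/andP[le_j _] _]; rewrite /a insubF ?scale0r // ltnNge le_j.
have := coef_le a _ i a_cvg; rewrite /a valK /= => ki_le.
rewrite -ltnS -(ltr_nat R); apply: le_lt_trans (truncnS_gt _).
rewrite ler_pdivlMr ?mulr_gt0 // natr_absz intr_norm.
have : `|(k i)%:~R : R| * (c * delta) <= `|(k i)%:~R * delta| * `|z i|.
  by rewrite normrM (gtr0_norm delta_gt0) -mulrA ler_wpM2l // mulrC ler_pM2l.
move=> /le_trans; apply; apply: le_trans ki_le _.
by rewrite ler_pM2l.
Qed.

End LowerEstimate.

(** * Counting integer combinations *)

Lemma exp_dominates_poly (a L : nat) :
  exists2 s, (0 < s)%N & (2 * (a * s).+1 ^ L <= 2 ^ s)%N.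
Proof.
have sq_le p : (4 <= p)%N -> (p * p <= 2 ^ p)%N.
  elim: p => // p IHp; rewrite leq_eqVlt => /orP[/eqP <- //|le_p].
  have := IHp le_p; rewrite expnS; nia.
(* With s = 2^p the left side is at most 2^(1 + (a+1+p) L), and p is large enough for this exponent
   to be at most p^2 <= 2^p. *)
pose p := (4 + L * a.+1 + L)%N; exists (2 ^ p)%N; first by rewrite expn_gt0.
have le_base : ((a * 2 ^ p).+1 <= 2 ^ (a.+1 + p))%N.
  rewrite expnD; have := ltn_expl a.+1 (isT : 1 < 2)%N.
  have : (0 < 2 ^ p)%N by rewrite expn_gt0.
  nia.
apply: (@leq_trans (2 * (2 ^ (a.+1 + p)) ^ L)%N).
  have [->|L_gt0] := posnP L; first by rewrite !expn0.
  by rewrite leq_mul2l leq_exp2r.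
rewrite -expnM -expnS leq_exp2l //; apply: leq_trans (sq_le p _); rewrite /p; nia.
Qed.

Lemma big_onth (V : nmodType) (T : Type) (s : seq T) (F : T -> V) L :
  (size s <= L)%N -> \sum_(i <- s) F i = \sum_(l < L) oapp F 0 (onth s l).
Proof.
elim: s L => [|i s IHs] [|L] //= le_L.
- by rewrite big_nil big_ord0.
- by rewrite big_nil big1 // => l _; rewrite onth0n.
- by rewrite big_cons big_ord_recl /= (IHs L).
Qed.

(** Dropping the terms with |x_i| < beta moves a combination by at most L delta B beta, so the large
    vectors alone still give a 1/2-net. Its points are coded by L letters, each an index with one of
    2B + 1 coefficients or a blank. *)
Lemma quantized_ball_card (R : realType) (X : normedModType R) d (v : 'I_d -> X)
    M (x : 'I_M -> X) (delta beta rho : R) (L B : nat) :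
    lin_indep v -> (forall i, lin_span v (x i)) -> 0 < delta -> 0 <= beta ->
    (forall u, lin_span v u -> `|u| <= 1 -> exists k : 'I_M -> int,
      [/\ (#|[set i | k i != 0%R]%SET| <= L)%N, forall i, (`|k i|%N <= B)%N &
          `|u - \sum_i (delta * (k i)%:~R) *: x i| <= rho]) ->
    rho + L%:R * (delta * B%:R * beta) <= 2^-1 ->
  (2 ^ d <= (B.*2.+1 * #|[set i | (beta <= `|x i|)%R]%SET|).+1 ^ L)%N.
Proof.
move=> indep_v x_span delta_gt0 beta_ge0 quant rho_le.
set I := [set i | beta <= `|x i|]%SET.
(* [None] pads supports of fewer than L elements, and the digit c stands for the coefficient c -
   B. *)
pose letter (o : option ('I_#|I| * 'I_B.*2.+1)) : X :=
  if o is Some jc then (delta * (jc.2%:R - B%:R)) *: x (enum_val jc.1) else 0.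
pose y (t : {ffun 'I_L -> option ('I_#|I| * 'I_B.*2.+1)}) := \sum_l letter (t l).
have -> : ((B.*2.+1 * #|I|).+1 ^ L)%N =
    #|{ffun 'I_L -> option ('I_#|I| * 'I_B.*2.+1)}|.
  by rewrite card_ffun card_option card_prod !card_ord mulnC.
apply: (half_net_card (y := y) indep_v) => [t|u u_span u_le1].
  have [a aE] := choice x_span.
  have letter_span o : lin_span v (letter o).
    case: o => [[j c]|] /=.
      rewrite aE scaler_sumr; eexists; apply: eq_bigr => i _; exact: scalerA.
    by exists (fun=> 0); rewrite big1 // => i _; rewrite scale0r.
  have [b bE] := choice letter_span.
  exists (fun i => \sum_l b (t l) i).
  under [RHS]eq_bigr do rewrite scaler_suml.
  by rewrite exchange_big; apply: eq_bigr => l _; rewrite -bE.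
have [k [supp_le k_le u_near]] := quant u u_span u_le1.
have k_itv i : (0 <= k i + B%:Z) && (k i + B%:Z < B.*2.+1%:Z) by have := k_le i; lia.
have code_lt i : (`|(k i + B%:Z)%R| < B.*2.+1)%N by have := k_le i; lia.
pose code i := Ordinal (code_lt i).
have codeE i : (code i)%:R - B%:R = (k i)%:~R :> R.
  rewrite /= natr_absz ger0_norm; last by have /andP[] := k_itv i.
  by rewrite intrD addrK.
pose S := [set j : 'I_#|I| | k (enum_val j) != 0]%SET.
pose s := [seq (j, code (enum_val j)) | j <- enum S].
have size_s : (size s <= L)%N.
  rewrite size_map -cardE; apply: leq_trans supp_le.
  rewrite -(card_imset S (@enum_val_inj _ (mem I))); apply: subset_leq_card.
  by apply/fintype.subsetP => _ /imsetP[j Sj ->]; rewrite !inE in Sj *.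
exists [ffun l => onth s (l : 'I_L)].
have -> : y [ffun l => onth s (l : 'I_L)] = \sum_(i in I) (delta * (k i)%:~R) *: x i.
  rewrite big_enum_val /y /=.
  under eq_bigr do rewrite ffunE.
  transitivity (\sum_(jc <- s) letter (Some jc)).
    rewrite (big_onth (fun jc => letter (Some jc)) size_s).
    by apply: eq_bigr => l _; case: (onth s l).
  rewrite /s big_map big_enum /= [RHS](bigID (mem S)) /=.
  rewrite [X in _ = _ + X]big1 ?addr0 => [|j]; last first.
    by rewrite inE negbK => /eqP ->; rewrite mulr0 scale0r.
  by apply: eq_bigr => j _; rewrite codeE.
have -> : u - \sum_(i in I) (delta * (k i)%:~R) *: x i =
    (u - \sum_i (delta * (k i)%:~R) *: x i) +
    \sum_(i | i \notin I) (delta * (k i)%:~R) *: x i.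
  by rewrite [in RHS](bigID (mem I)) /= opprD addrA subrK.
apply: le_trans (ler_normD _ _) _; apply: le_trans rho_le; apply: lerD => //.
apply: le_trans (ler_norm_sum _ _ _) _.
apply: (@le_trans _ _ (\sum_(i in [set i | k i != 0]%SET) delta * B%:R * beta));
  last first.
  rewrite sumr_const -[X in X <= _]mulr_natl ler_wpM2r ?ler_nat //.
  by rewrite !mulr_ge0 // ltW.
rewrite big_mkcond [leRHS]big_mkcond /=; apply: ler_sum => i _.
rewrite !inE -ltNge; case: ifPn => [lt_i|_]; last first.
  by case: ifP => // _; rewrite !mulr_ge0 // ltW.
have [->|ki_neq0] := eqVneq (k i) 0; first by rewrite mulr0 scale0r normr0.
rewrite normrZ normrM (gtr0_norm delta_gt0); apply: ler_pM => //.
- by rewrite mulr_ge0 // ltW.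
- by rewrite ler_pM2l // -intr_norm -natr_absz ler_nat.
- exact: ltW.
Qed.

(** * Sign sums under a finite limsup *)

Lemma limn_esup_bound (R : realType) (u : nat -> \bar R) :
  limn_esup u <> +oo%E -> exists D : R, \forall n \near \oo, (u n <= D%:E)%E.
Proof.
move=> /eqP; rewrite -ltey => /ereal_inf_lt[_ [V V_oo <-] sup_lt].
(* The maximum with 0 excludes the value -oo, so that [fine] is faithful. *)
exists (fine (Order.max (ereal_sup [set u x | x in V]) 0%E)).
apply: filterS V_oo => n Vn.
rewrite fineK; last first.
  rewrite fin_numElt gt_max sup_lt ltey andbT.
  by rewrite (lt_le_trans (ltNyr 0)) // le_max lexx orbT.
by rewrite le_max ereal_sup_ubound //; exists n.
Qed.

(** If the terms are eventually at most D, sign sums of m vectors have norm at most D m / ln m,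
    which is at most eta m once ln m >= D / eta. *)
Lemma small_sign_sums (R : realType) (Z : normedModType R) (z : nat -> Z) (eta : R) :
    0 < eta ->
    limn_esup (fun n : nat => ((ln n%:R / n%:R)%:E *
      ereal_sup [set t%:E | t in sign_norms z n])%E) <> +oo%E ->
  exists2 m, (0 < m)%N & forall (r : seq nat) (eps : nat -> bool),
    uniq r -> size r = m -> `|\sum_(j <- r) (-1) ^+ eps j *: z j| <= eta * m%:R.
Proof.
move=> eta_gt0 /limn_esup_bound[D [n0 _ le_D]].
pose x := Num.max (D / eta) 1.
pose m := (n0 + (Num.truncn (expR x)).+1)%N.
have m_gt0 : (0 < m)%N by rewrite /m addnS.
exists m => // r eps r_uniq sz_r.
have m_gt0' : 0 < m%:R :> R by rewrite ltr0n.
have x_le : x <= ln m%:R.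
  rewrite -[x]expRK ler_ln ?posrE ?expR_gt0 //.
  apply: le_trans (ltW (truncnS_gt _)) _.
  by rewrite ler_nat leq_addl.
have ln_gt0 : 0 < ln m%:R :> R by apply: lt_le_trans x_le; rewrite lt_max ltr01 orbT.
have D_le : D <= eta * ln m%:R.
  by rewrite mulrC -ler_pdivrMr //; apply: le_trans x_le; rewrite le_max lexx.
have r_perm : perm_eq [fset j in r]%fset r by apply: uniq_perm => // j; rewrite inE.
have : ((ln m%:R / m%:R)%:E * (`|\sum_(j <- r) (-1) ^+ eps j *: z j|)%:E <= D%:E)%E.
  apply: le_trans (le_D m (leq_addr _ _)); apply: lee_wpmul2l.
    by rewrite lee_fin divr_ge0 // ltW.
  apply: ereal_sup_ubound; eexists; last reflexivity.
  exists [fset j in r]%fset, eps; split; first by rewrite (perm_size r_perm).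
  by rewrite (perm_big _ r_perm).
rewrite -EFinM lee_fin mulrAC ler_pdivrMr // => /le_trans.
move=> /(_ _ (ler_wpM2r (ltW m_gt0') D_le)).
by rewrite [eta * _]mulrC -mulrA ler_pM2l.
Qed.

(** * Arithmetic of the exponential bounds *)

Lemma exponential_growth_base (R : realType) (W e : nat) :
  exists2 c : R, 1 < c & exists D : nat, forall d M : nat,
    (D <= d)%N -> (2 ^ d <= (W * M).+1 ^ e)%N -> c ^+ d <= M%:R.
Proof.
(* Half of the exponent in c^(2(e+1)) = 2 absorbs the factor W + 1, at most c^d for d >= D; the
   other half is left for M. Using e + 1 keeps the exponent nonzero. *)
pose c : R := 2 `^ ((2 * e.+1)%:R^-1).
have c_ge0 : 0 <= c by exact: powR_ge0.
have cE : c ^+ (2 * e.+1) = 2.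
  by rewrite -powR_mulrn // -powRrM mulVf ?powRr1 // pnatr_eq0.
have c_gt1 : 1 < c.
  rewrite ltNge; apply/negP => c_le1; have := exprn_ile1 (2 * e.+1) c_ge0 c_le1.
  by rewrite cE; lra.
exists c => //; exists (2 * e.+1 * W.+1)%N => d M le_d le_M.
have M_gt0 : (0 < M)%N.
  rewrite lt0n; apply/eqP => M0; move: le_M; rewrite M0 muln0 exp1n.
  by rewrite leqNgt -{1}(expn0 2) ltn_exp2l // (leq_trans _ le_d).
have W_le : W.+1%:R <= c ^+ d.
  apply: (@le_trans _ _ (c ^+ (2 * e.+1 * W.+1))); last by rewrite ler_weXn2l // ltW.
  by rewrite exprM cE -natrX ler_nat ltnW // ltn_expl.
rewrite leNgt; apply/negP => lt_M.
have lt_WM : W.+1%:R * M%:R < c ^+ (2 * d).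
  rewrite mul2n -addnn exprD; apply: le_lt_trans (ler_wpM2r _ W_le) _ => //.
  by rewrite ltr_pM2l // (lt_le_trans _ W_le).
have : (2 ^ d <= (W.+1 * M) ^ e.+1)%N.
  apply: leq_trans le_M _; apply: (@leq_trans ((W.+1 * M) ^ e)%N).
    by have [->|e_gt0] := posnP e; rewrite ?expn0 // leq_exp2r // mulSn; lia.
  by rewrite leq_pexp2l // muln_gt0.
rewrite -(ler_nat R) !natrX natrM leNgt => /negP; apply.
apply: (@lt_le_trans _ _ ((c ^+ (2 * d)) ^+ e.+1)).
  by rewrite ltr_pXn2r // ?nnegrE ?mulr_ge0 // exprn_ge0.
by rewrite -exprM mulnAC exprM cE.
Qed.

(** Up to replacing q by max(q, 1), the s-th power of the first bound gives 2^(d s) <= G^(L s)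
    (q^s)^L <= G^(L s) K^(d L), while (2 K^L)^d <= 2^(d s). Cancelling K^(d L) leaves a bound on 2^d
    that does not involve d. *)
Lemma dimension_bound (d c q s m K L W : nat) :
    (0 < s)%N -> (0 < m)%N -> (2 ^ d <= (W * c).+1 ^ L)%N ->
    (c < q.+1 * (s * m))%N -> (q ^ s <= K ^ d)%N -> (0 < K)%N ->
    (2 * K ^ L <= 2 ^ s)%N ->
  (2 ^ d <= (2 * W.+1 * (s * m)) ^ (L * s))%N.
Proof.
move=> s_gt0 m_gt0 le_d lt_c le_q K_gt0 le_K.
have [L0|L_gt0] := posnP L; first by move: le_d; rewrite L0 mul0n !expn0.
pose q' := maxn q 1; have q'_gt0 : (0 < q')%N by rewrite /q' leq_max orbT.
have le_q' : (q' ^ s <= K ^ d)%N.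
  by rewrite /q'; case: (leqP q 1) => _ //; rewrite exp1n expn_gt0 K_gt0.
set G := (2 * W.+1 * (s * m))%N.
have sm_gt0 : (0 < s * m)%N by rewrite muln_gt0 s_gt0.
have le_G : ((W * c).+1 <= G * q')%N.
  have le_q2 : (q.+1 <= 2 * q')%N by rewrite /q'; lia.
  have {lt_c} lt_c : (c < 2 * q' * (s * m))%N.
    by apply: leq_trans lt_c _; rewrite leq_mul2r le_q2 orbT.
  have -> : (G * q' = W.+1 * (2 * q' * (s * m)))%N by rewrite /G; ring.
  have := leq_mul (leqnn W) (ltnW lt_c); rewrite mulSn; lia.
have : (2 ^ (d * s) <= (G * q') ^ (L * s))%N.
  by rewrite !expnM leq_exp2r // (leq_trans le_d) // leq_exp2r.
rewrite expnMn [(q' ^ _)%N](_ : _ = ((q' ^ s) ^ L)%N); last by rewrite -expnM mulnC.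
have le_KL : ((2 * K ^ L) ^ d <= 2 ^ (d * s))%N.
  have [->|d_gt0] := posnP d; first by rewrite mul0n !expn0.
  by rewrite [(d * s)%N]mulnC [in leqRHS]expnM leq_exp2r.
have le_qL : ((q' ^ s) ^ L <= (K ^ d) ^ L)%N by rewrite leq_exp2r.
move=> /(leq_trans le_KL); rewrite expnMn => le_all.
have KdL_gt0 : (0 < (K ^ d) ^ L)%N by rewrite !expn_gt0 K_gt0.
rewrite -(leq_pmul2r KdL_gt0).
apply: leq_trans (leq_mul (leqnn _) le_qL); apply: leq_trans le_all.
by rewrite leq_mul2l -!expnM mulnC leqnn orbT.
Qed.

(** * Choice of the constants and both conclusions *)

Theorem corollary4p4 (R : realType) (X Z : completeNormedModType R)
    (x : nat -> X) (f : nat -> {linear X -> R^o}) (z : nat -> Z)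
    (P : nat -> {linear X -> X}) (eps delta C r : R) (M : nat -> nat)
    (frame_xf : schauder_frame x f)
    (infinite_X : ~ finite_dim [set: X])
    (projection_P : forall n, finite_rank_projection (P n))
    (bounded_P : exists K : R, forall n, opnorm (P n) <= K)
    (approx_P : forall u : X, P n u @[n --> \oo] --> u)
    (eps_gt0 : 0 < eps) (delta_gt0 : 0 < delta) (C_ge1 : 1 <= C)
    (basis_z : schauder_basis z)
    (NQP_xf : NQP eps delta C x f z)
    (r_bounds : 1 / 2 < r < 1)
    (q_lt1 : (1 - r) / r
             + sup (range (fun n => opnorm (P n))) * (2 * eps / r) < 1)
    (M_i : forall (n : nat) (u : X) (N : nat),
       range (P n) u -> (M n <= N)%N ->
       `|u - \sum_(i < N) f i u *: P n (x i)| <= (1 - r) * `|u|)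
    (M_ii : forall (n : nat) (u : X), range (P n) u ->
       exists k : 'I_(M n) -> int,
         `|\sum_(i < M n) ((k i)%:~R * delta) *: z i| <= C * `|u| /\
         `|u - \sum_(i < M n) (delta * (k i)%:~R) *: x i| <= eps)
    (lower_z : inf (lower_norms z n) @[n --> \oo] --> +oo) :
  (exists c : R, 1 < c /\
     \forall n \near \oo, c ^+ lin_dim (range (P n)) <= (M n)%:R) /\
  limn_esup (fun n : nat => ((ln n%:R / n%:R)%:E *
     ereal_sup [set t%:E | t in sign_norms z n])%E) = +oo%E.
Proof.
set kappa := sup _ in q_lt1.
have P_le n u : `|P n u| <= kappa * `|u|.
  have [P_cont _ _] := projection_P n.
  apply: le_trans (opnorm_bound u P_cont) _; rewrite ler_wpM2r //.
  apply: ub_le_sup; last by exists n.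
  by have [K K_ge] := bounded_P; exists K => _ [n' _ <-].
have /andP[r_gt r_lt] := r_bounds.
have kappa_ge0 : 0 <= kappa.
  have [w w_gt0] : exists w : X, 0 < `|w|.
    have [v indep_v] := lin_indep_exists 1 infinite_X; exists (v ord0).
    rewrite normr_gt0; apply/eqP => v0.
    have := indep_v (fun=> 1); rewrite big_ord1 v0 scaler0 => /(_ erefl ord0)/eqP.
    by rewrite oner_eq0.
  by rewrite -(pmulr_lge0 _ w_gt0) (le_trans _ (P_le 0%N w)).
(* The hypothesis reads 1 - r + 2 kappa eps < r, whence kappa eps < r - 1/2 < 1/2. *)
have kappa_eps : kappa * eps < 2^-1.
  have r_gt0 : 0 < r by lra.
  move: q_lt1; rewrite mulrA -mulrDl ltr_pdivrMr //; lra.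
pose gap := 2^-1 - kappa * eps; have gap_gt0 : 0 < gap by rewrite subr_gt0.
have [L [B coefs_le]] := small_norm_coefs lower_z C basis_z delta_gt0.
(* Dropping the vectors shorter than beta may cost what kappa eps leaves of 1/2; the added 1 keeps
   the denominator positive. *)
pose beta := gap / (L%:R * (delta * B%:R) + 1).
have den_gt0 : 0 < L%:R * (delta * B%:R) + 1.
  by rewrite ltr_wpDl // !mulr_ge0 // ltW.
have beta_gt0 : 0 < beta by rewrite divr_gt0.
have beta_le : kappa * eps + L%:R * (delta * B%:R * beta) <= 2^-1.
  rewrite -lerBrDl -/gap mulrA.
  have -> : gap = beta * (L%:R * (delta * B%:R) + 1) by rewrite divfK ?gt_eqF.
  have := ltW beta_gt0; lra.
pose I n := [set i : 'I_(M n) | beta <= `|P n (x i)|]%SET.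
have dim_le n : (2 ^ lin_dim (range (P n)) <= (B.*2.+1 * #|I n|).+1 ^ L)%N.
  have [_ P_idem [d dim_d]] := projection_P n.
  have [v [indep_v spanE]] := dim_d; rewrite (lin_dimE dim_d).
  apply: (quantized_ball_card (rho := kappa * eps) (delta := delta) indep_v) => //.
  - by move=> i; rewrite -spanE; exists (x i).
  - exact: ltW.
  move=> u; rewrite -spanE => u_range u_le1.
  have [k [k_norm k_near]] := M_ii n u u_range.
  have [k_supp k_le] : (#|[set i | k i != 0%R]%SET| <= L)%N /\
      forall i, (`|k i|%N <= B)%N.
    apply: coefs_le; apply: le_trans k_norm _.
    by rewrite ler_piMr // (le_trans _ C_ge1).
  exists k; split => //.
  have Pu : P n u = u by have [w _ <-] := u_range; exact: P_idem.
  have -> : u - \sum_i (delta * (k i)%:~R) *: P n (x i) =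
      P n (u - \sum_i (delta * (k i)%:~R) *: x i).
    rewrite (linearB (P n)) Pu (linear_sum (P n)); congr (_ - _).
    by apply: eq_bigr => i _; rewrite linearZ.
  by apply: le_trans (P_le _ _) _; rewrite ler_wpM2l.
have dim_large D := lin_dim_range_unbounded D infinite_X projection_P approx_P.
split.
  have [c c_gt1 [D c_le]] := exponential_growth_base R B.*2.+1 L.
  exists c; split => //; apply: filterS (dim_large D) => n le_D.
  apply: c_le le_D _; apply: leq_trans (dim_le n) _.
  have [->|L_gt0] := posnP L; first by rewrite !expn0.
  rewrite leq_exp2r // ltnS leq_mul2l; apply/orP; right.
  by rewrite -[leqRHS]card_ord max_card.
apply: contrapT => not_pinfty.
have [[[S [S_cont S_series]] _] _] := NQP_xf.
have Sz i : S (z i) = x i.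
  have delta_cvg (U : normedModType R) (y : nat -> U) :
      series (fun j => (j == i)%:R *: y j) @ \oo --> y i.
    apply: cvg_near_cst; exists i.+1 => // n /= lt_in.
    rewrite /series /= big_mkord (bigD1 (Ordinal lt_in)) //= eqxx scale1r.
    by rewrite big1 ?addr0 // => j /negPf; rewrite -val_eqE /= => ->; rewrite scale0r.
  exact: (cvg_unique _ (S_series _ _ (delta_cvg Z z)) (delta_cvg X x)).
have [sigma sigma_gt0 S_le] : exists2 sigma : R, 0 < sigma &
    forall y, `|S y| <= sigma * `|y|.
  exists (`|opnorm S| + 1) => [|y]; first by rewrite ltr_wpDl.
  apply: le_trans (opnorm_bound y S_cont) _; rewrite ler_wpM2r //.
  by rewrite (le_trans (ler_norm _)) // lerDl.
have [m1 m1_gt0 sum_le1] := small_sign_sums ltr01 not_pinfty.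
(* 2 z_i is the difference of two sign sums of m1 vectors that differ only in the sign at i. *)
have z_le i : `|z i| <= m1%:R.
  have m1E : m1 = m1.-1.+1 by rewrite prednK.
  have iotaE : iota i m1 = i :: iota i.+1 m1.-1 by rewrite {1}m1E.
  have := sum_le1 (iota i m1) xpred0 (iota_uniq _ _) (size_iota _ _).
  have := sum_le1 (iota i m1) (pred1 i) (iota_uniq _ _) (size_iota _ _).
  rewrite iotaE !big_cons /= eqxx expr1 expr0 scale1r scaleN1r mul1r.
  rewrite (@eq_big_seq _ _ _ _ (iota i.+1 m1.-1) _ (fun j => (-1) ^+ 0 *: z j)).
    set t := \sum_(j <- _) _ => le1 le2.
    have := ler_normB (z i + t) (- z i + t).
    rewrite opprD opprK addrACA subrr addr0 -mulr2n normrMn -mulr_natl.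
    by lra.
  move=> j; rewrite mem_iota => /andP[lt_ij _].
  by rewrite gtn_eqF.
pose kp := kappa + 1; have kp_gt0 : 0 < kp by rewrite ltr_wpDl.
have PS_le n y : `|P n (S y)| <= kp * sigma * `|y|.
  by apply: le_trans (P_le _ _) _; rewrite -mulrA ler_pM // lerDl.
pose bd := kp * sigma * m1%:R.
have bd_ge0 : 0 <= bd by rewrite !mulr_ge0 // ltW.
(* Order of choice: a makes K = a s admissible in [large_vectors_card] for every s; s makes 2^s
   dominate (a s + 1)^L; eta is beta / (4 s) up to the bound for P_n S; m comes from eta. Then G is
   fixed, and n0 with d >= G contradicts 2^d <= G. *)
pose a := (Num.truncn (8 * bd / beta)).+1.
have [s s_gt0 le_s] := exp_dominates_poly a L.
have s_gt0' : 0 < s%:R :> R by rewrite ltr0n.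
pose eta := beta / (4 * s%:R) / (kp * sigma).
have eta_gt0 : 0 < eta by rewrite !divr_gt0 // ?mulr_gt0.
have [m m_gt0 sum_le] := small_sign_sums eta_gt0 not_pinfty.
pose G := ((2 * B.*2.+2 * (s * m)) ^ (L * s))%N.
have [n0 _ /(_ n0 (leqnn n0)) /= dim_n0] := dim_large G.
set d := lin_dim _ in dim_n0.
suff : (2 ^ d <= G)%N.
  by rewrite leqNgt (leq_ltn_trans dim_n0) // ltn_expl.
have [_ _ [d' dim_d]] := projection_P n0.
have [v [indep_v spanE]] := dim_d.
pose q := (#|I n0| %/ (s * m))%N.
apply: (dimension_bound (q := q) (K := (a * s).+1) s_gt0 m_gt0 (dim_le n0)) => //.
  by rewrite /q -ltn_divLR // muln_gt0 s_gt0.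
rewrite (lin_dimE dim_d).
apply: (large_vectors_card (x := fun i : 'I_(M n0) => P n0 (x i))
  (m := m) (beta := beta) (B := bd) (I := I n0) indep_v) => //.
- by move=> i; rewrite -spanE; exists (x i).
- by rewrite muln_gt0 s_gt0.
- move=> i; rewrite -Sz; apply: le_trans (PS_le _ _) _.
  by rewrite ler_wpM2l // mulr_ge0 // ltW.
- have : 8 * bd / beta < a%:R by rewrite truncnS_gt.
  rewrite ltr_pdivrMr // natrM => /ltW le_a.
  by rewrite mulrAC [leRHS]mulrAC ler_wpM2r // ltW.
- move=> A e card_A.
  have -> : \sum_(t in A) (-1) ^+ e t *: P n0 (x t) =
      P n0 (S (\sum_(t in A) (-1) ^+ e t *: z t)).
    rewrite !linear_sum; apply: eq_bigr => t _.
    by rewrite !linearZ -Sz.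
  apply: le_trans (PS_le _ _) _.
  have -> : beta / (4 * s%:R) = kp * sigma * eta.
    by rewrite /eta [RHS]mulrC divfK // mulf_neq0 // gt_eqF.
  rewrite -[leRHS]mulrA ler_pM2l ?mulr_gt0 //.
  pose e' j := if insub j is Some t then e t else false.
  have := sum_le [seq val t | t <- enum A] e'.
  rewrite map_inj_uniq ?enum_uniq; last exact: val_inj.
  rewrite size_map -cardE card_A big_map big_enum => /(_ isT erefl).
  by under eq_bigr do rewrite /e' valK.
- by move=> i; rewrite inE.
- by rewrite -mulnA leq_trunc_div.
Qed.
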